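(* Fix $a\in\mathbb{N}$. Every arithmetic progression contains infinitely many positive integers $b$ with $d(a,b)\leq 6$. More precisely, every arithmetic progression containing integers of the same parity as $a$ contains infinitely many positive integers $b$ of the same parity as $a$ with $d(a,b)\leq 5$.
   Context: Let $\mathbb{N}=\{1,2,\ldots\}$. $G$ is the undirected simple graph with vertex set $\mathbb{N}$ in which $x\sim y$ if and only if $|x-y|=1$ or $\max\{x,y\}/\min\{x,y\}$ is a prime number. $d(x,y)$ denotes graph distance in $G$. An arithmetic progression means a residue class $\{n\in\mathbb{Z}: n\equiv\beta\pmod M\}$ with $M\geq 1$ and $\beta\in\mathbb{Z}$. *)

(* Defs.v *)
From HB Require Import structures.
From mathcomp Require Import all_boot all_order all_algebra.
From mathcomp Require Import boolp classical_sets cardinality.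

Set Implicit Arguments.
Unset Strict Implicit.
Unset Printing Implicit Defensive.

Import Order.TTheory GRing.Theory Num.Theory.

Local Open Scope nat_scope.

Definition vertex := {n : nat | 0 < n}.

(* As the minimum is positive and divides the maximum in the second case, the
   truncated quotient is the exact one. *)
Definition adj (x y : vertex) : bool :=
  let m := minn (val x) (val y) in
  let M := maxn (val x) (val y) in
  (M - m == 1) || ((m %| M) && prime (M %/ m)).

Definition walk (x y : vertex) (k : nat) : Prop :=
  exists p : seq vertex, [/\ path adj x p, last x p = y & size p = k].

Lemma adjC (x y : vertex) : adj x y = adj y x.
Proof. by rewrite /adj minnC maxnC. Qed.

Lemma adj_irrefl (x : vertex) : adj x x = false.
Proof. by rewrite /adj minnn maxnn subnn dvdnn divnn (valP x). Qed.

Lemma walk_rcons (x y z : vertex) (k : nat) :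
  walk x y k -> adj y z -> walk x z k.+1.
Proof.
move=> [p [xp <- <-]] yz; exists (rcons p z).
by rewrite rcons_path xp last_rcons size_rcons.
Qed.

Lemma walk_connected (x y : vertex) : exists k : nat, `[< walk x y k >].
Proof.
have [d] := ubnP (maxn (val x) (val y) - minn (val x) (val y)).
elim: d y => // d IH y; rewrite ltnS => le_d.
have [xy|yx|xy] := ltngtP (val x) (val y).
- have y1 : 0 < (val y).-1.
    by rewrite -ltnS prednK ?(leq_trans _ xy) ?ltnS ?(valP x) // (valP y).
  have [|k /asboolP wk] := IH (exist (fun n => is_true (0 < n)) _ y1).
    have le_xy : val x <= (val y).-1 by rewrite -ltnS prednK // (valP y).
    move: le_d; rewrite /= (maxn_idPr (ltnW xy)) (minn_idPl (ltnW xy)).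
    rewrite (maxn_idPr le_xy) (minn_idPl le_xy); apply: leq_trans.
    by rewrite ltn_sub2r // prednK // (valP y).
  exists k.+1; apply/asboolP; apply: walk_rcons wk _.
  rewrite /adj /= (minn_idPl (leq_pred _)) (maxn_idPr (leq_pred _)).
  by rewrite -subn1 subKn ?(valP y).
- have [|k /asboolP wk] := IH (exist (fun n => is_true (0 < n)) _ (ltn0Sn (val y))).
    move: le_d; rewrite /= (maxn_idPl (ltnW yx)) (minn_idPr (ltnW yx)).
    rewrite (maxn_idPl yx) (minn_idPr yx); apply: leq_trans.
    by rewrite ltn_sub2l.
  exists k.+1; apply/asboolP; apply: walk_rcons wk _.
  by rewrite /adj /= (minn_idPr (leqnSn _)) (maxn_idPl (leqnSn _)) subSnn.
- exists 0; apply/asboolP; exists [::]; split=> //=.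
  exact: val_inj.
Qed.

Definition dist (x y : vertex) : nat := ex_minn (walk_connected x y).

Local Open Scope classical_set_scope.

Definition arith_prog (M : nat) (beta : int) : set int :=
  [set n : int | (n = beta %[mod M%:Z])%Z].

Definition same_parity (m n : int) : Prop := (m = n %[mod 2])%Z.

(* Main.v *)
(** Starting from [a], multiply by a prime [p], add 1, multiply by a prime [q],
    subtract 1 and multiply by a prime [r].  After passing to a modulus [M]
    divisible by 4 and a residue [n] of the parity of [a], Dirichlet's theorem
    supplies [p] and [s] such that [a p + 1] and [n s + 1] have the same gcd with
    [M] (1 or 2, according to that parity), then [q] with
    [(a p + 1) q = n s + 1] modulo [M], and finally arbitrarily large [r] with
    [r s = 1]; the walk ends at a vertex congruent to [n].

    Dirichlet's theorem is proved by partial sums, after Mertens and Shapiro.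
    For a character [chi] modulo [M], let [L(N)] be the sum of [chi(n) / n] and
    [S(N)] that of [chi(n) Lambda(n) / n], over [n <= N].  If [L] stays away
    from 0 then [S] is bounded, since [S L] is close to the bounded sum of
    [chi(n) ln n / n]; otherwise [L(N) = O(1 / N)] and Moebius inversion gives
    [S(N) = - ln N + O(1)].  Positivity of the sum of [Lambda(n) / n] over
    [n = 1] modulo [M] allows at most one such exceptional character, which is
    then real, and Monsky's argument with Lambert series excludes it. *)

Require Import Defs.
From HB Require Import structures.
From mathcomp Require Import all_boot all_order all_algebra.
From mathcomp Require Import all_fingroup all_solvable all_field all_character.
From mathcomp Require Import complex.
From mathcomp Require Import zify ring lra.
From mathcomp Require Import boolp classical_sets cardinality reals exp Rstruct.

Set Implicit Arguments.
Unset Strict Implicit.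
Unset Printing Implicit Defensive.

Import Order.TTheory GRing.Theory Num.Theory.

(** * Sums over divisors *)

Section DirichletTheorem.
Local Open Scope ring_scope.

Section DivisorSums.
Variable V : nmodType.

Lemma sum_divisors_cond (F : nat -> V) (n N : nat) : (0 < n <= N)%N ->
  \sum_(d <- divisors n) F d = \sum_(1 <= d < N.+1 | (d %| n)%N) F d.
Proof.
case/andP=> n0 nN; rewrite -[RHS]big_filter; apply: perm_big.
apply: uniq_perm; rewrite ?divisors_uniq ?filter_uniq ?iota_uniq // => d.
rewrite -dvdn_divisors // mem_filter mem_index_iota.
case dn: (d %| n)%N => //=.
by have := dvdn_leq n0 dn; have := dvdn_gt0 n0 dn; lia.
Qed.

Lemma sum_multiples (F : nat -> V) (d N : nat) : (0 < d)%N ->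
  \sum_(1 <= n < N.+1 | (d %| n)%N) F n
  = \sum_(1 <= m < (N %/ d).+1) F (d * m)%N.
Proof.
move=> d0; rewrite -[LHS]big_filter -(big_map (muln d) xpredT F); apply: perm_big.
apply: uniq_perm; rewrite ?filter_uniq ?map_inj_in_uniq ?iota_uniq //.
  by move=> x y _ _ /eqP; rewrite eqn_pmul2l // => /eqP.
move=> n; rewrite mem_filter mem_index_iota; apply/idP/mapP.
  case/andP=> /dvdnP[m ->] h; exists m; last by rewrite mulnC.
  rewrite mem_index_iota ltnS leq_divRL //.
  by move: h; case: m => //; lia.
case=> m; rewrite mem_index_iota ltnS leq_divRL // => h ->.
rewrite dvdn_mulr //=; nia.
Qed.

(** Both sides run over the pairs [(d, m)] with [d * m <= N], grouped by their product on the left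
    and by [d] on the right. *)
Lemma sum_divisors_hyperbola (F : nat -> nat -> V) (N : nat) :
  \sum_(1 <= n < N.+1) \sum_(d <- divisors n) F d (n %/ d)%N
  = \sum_(1 <= d < N.+1) \sum_(1 <= m < (N %/ d).+1) F d m.
Proof.
transitivity (\sum_(1 <= n < N.+1) \sum_(1 <= d < N.+1 | (d %| n)%N)
    F d (n %/ d)%N).
  by apply: eq_big_nat => n nN; apply: sum_divisors_cond; lia.
rewrite (exchange_big_dep_nat xpredT) //=; apply: eq_big_nat => d dN.
rewrite sum_multiples; last by lia.
by apply: eq_bigr => m _; rewrite mulKn //; lia.
Qed.

(** By unique factorisation each divisor of [p ^ k * m] is [p ^ j * e] for exactly one pair with
    [j <= k] and [e] dividing [m]. Together with [pfactor_ind] this proves the divisor-sum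
    identities below. *)
Lemma sum_divisors_pfactor (F : nat -> V) (p k m : nat) :
  prime p -> (0 < m)%N -> coprime p m ->
  \sum_(d <- divisors (p ^ k * m)) F d
  = \sum_(0 <= j < k.+1) \sum_(e <- divisors m) F (p ^ j * e)%N.
Proof.
move=> pp m0 cpm; have p0 := prime_gt0 pp.
rewrite -(@big_allpairs_dep _ _ _ _ (fun=> nat) nat (fun j e => (p ^ j * e)%N)).
apply: perm_big.
have n0 : (0 < p ^ k * m)%N by rewrite muln_gt0 expn_gt0 p0.
have cop e : (e %| m)%N -> coprime p e by move=> em; apply: coprime_dvdr cpm.
apply: uniq_perm; rewrite ?divisors_uniq //.
  apply: allpairs_uniq; rewrite ?iota_uniq ?divisors_uniq //.
  move=> _ _ /allpairsPdep[i [e [_ ei ->]]] /allpairsPdep[j [f [_ fj ->]]] /=.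
  rewrite -!dvdn_divisors // in ei fj => eq_pf.
  have lognK h g : (g %| m)%N -> logn p (p ^ h * g) = h.
    move=> gm; rewrite lognM ?expn_gt0 ?p0 ?(dvdn_gt0 m0 gm) // pfactorK //.
    by rewrite logn_coprime ?addn0 // cop.
  have eij : i = j by rewrite -(lognK i e ei) -(lognK j f fj) eq_pf.
  by move: eq_pf; rewrite eij => /eqP; rewrite eqn_pmul2l ?expn_gt0 ?p0 // => /eqP->.
move=> d; rewrite -dvdn_divisors //; apply/idP/allpairsPdep.
  move=> dn; have d0 := dvdn_gt0 n0 dn.
  have [e cpe de] := pfactor_coprime pp d0.
  exists (logn p d), e; split.
  - rewrite mem_index_iota /= ltnS -(pfactorK k pp).
    have -> : logn p (p ^ k) = logn p (p ^ k * m).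
      by rewrite lognM ?expn_gt0 ?p0 // (logn_coprime cpm) addn0.
    exact: dvdn_leq_log.
  - rewrite -dvdn_divisors // -(@Gauss_dvdr _ (p ^ k)).
      by apply: dvdn_trans dn; rewrite [X in (_ %| X)%N]de dvdn_mulr.
    by rewrite coprime_sym coprimeXl.
  - by rewrite mulnC -de.
case=> j [e [hj he ->]]; rewrite -dvdn_divisors // in he.
by rewrite mem_index_iota /= ltnS in hj; rewrite dvdn_mul // dvdn_exp2l.
Qed.

End DivisorSums.

(** Strong induction on [n], splitting off the full power of its least prime factor. *)
Lemma pfactor_ind (P : nat -> Prop) :
  P 1%N ->
  (forall p k m, prime p -> (0 < k)%N -> (0 < m)%N -> coprime p m ->
     P m -> P (p ^ k * m)%N) ->
  forall n, (0 < n)%N -> P n.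
Proof.
move=> P1 PM n; have [b] := ubnP n; elim: b n => // b IH n nb n0.
have [->//|n1] := eqVneq n 1%N.
have n2 : (1 < n)%N by lia.
have pp := pdiv_prime n2; have [m cpm en] := pfactor_coprime pp n0.
have k0 : (0 < logn (pdiv n) n)%N by rewrite logn_gt0 mem_primes pp n0 pdiv_dvd.
have m0 : (0 < m)%N by case: m en {cpm} => [|//]; lia.
rewrite en mulnC; apply: PM => //; apply: IH => //.
apply: leq_trans (_ : n <= b)%N; last by lia.
by rewrite [X in (_ < X)%N]en ltn_Pmulr // -{1}(expn0 (pdiv n)) ltn_exp2l // prime_gt1.
Qed.

Lemma primes_pfactor (p k m : nat) : prime p -> (0 < k)%N -> (0 < m)%N ->
  coprime p m -> perm_eq (primes (p ^ k * m)) (p :: primes m).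
Proof.
move=> pp k0 m0 cpm; apply: uniq_perm; rewrite /= ?primes_uniq ?andbT //.
  by rewrite mem_primes pp m0 /= -prime_coprime.
move=> q; rewrite primesM ?expn_gt0 ?(prime_gt0 pp) //.
by rewrite primesX // primes_prime // !inE.
Qed.

(** * The von Mangoldt and Moebius functions *)

Section ArithmeticFunctions.
Variable R : realType.
Implicit Types n p k m : nat.

(** The list [primes n] is a singleton exactly when [n] is a power of a prime with positive
    exponent. *)
Definition vonMangoldt n : R := if primes n is [:: p] then ln p%:R else 0.

Lemma vonMangoldt_pfactor p k m : prime p -> (0 < k)%N -> (0 < m)%N ->
  coprime p m ->
  vonMangoldt (p ^ k * m) = if m == 1%N then ln p%:R else 0.
Proof.
move=> pp k0 m0 cpm; rewrite /vonMangoldt.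
have perm := primes_pfactor pp k0 m0 cpm; have sz := perm_size perm.
have [m1|m1] := eqVneq m 1%N.
  by move: perm; rewrite m1 /= => /perm_small_eq -> //.
have : (0 < size (primes m))%N.
  have m2 : (1 < m)%N by lia.
  have : pdiv m \in primes m by rewrite mem_primes pdiv_prime // m0 pdiv_dvd.
  by case: (primes m).
by move: sz => /=; case: (primes _) => [|? []] //= [<-].
Qed.

Lemma vonMangoldt1 : vonMangoldt 1 = 0. Proof. by []. Qed.

Lemma vonMangoldt_ge0 n : 0 <= vonMangoldt n.
Proof.
rewrite /vonMangoldt; case e: (primes n) => [|p []] //.
have : p \in primes n by rewrite e inE.
rewrite mem_primes => /and3P[pp _ _]; apply: ln_ge0.
by rewrite ler1n prime_gt0.
Qed.

Lemma ln_natM m n : (0 < m)%N -> (0 < n)%N ->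
  ln (m * n)%:R = ln m%:R + ln n%:R :> R.
Proof. by move=> m0 n0; rewrite natrM lnM // posrE ltr0n. Qed.

Lemma ln_natX m k : (0 < m)%N -> ln (m ^ k)%:R = k%:R * ln m%:R :> R.
Proof. by move=> m0; rewrite natrX lnXn ?ltr0n // mulr_natl. Qed.

(** For [p ^ k * m] the divisors prime to [p] give [ln m] by induction; among the others only
    [p, ..., p ^ k] count, each for [ln p]. *)
Lemma sum_vonMangoldt n : (0 < n)%N ->
  \sum_(d <- divisors n) vonMangoldt d = ln n%:R.
Proof.
move=> n0; elim/pfactor_ind: n / n0.
  by rewrite big_cons big_nil /= vonMangoldt1 addr0 ln1.
move=> p k m pp k0 m0 cpm IH; have p0 := prime_gt0 pp.
rewrite sum_divisors_pfactor // big_nat_recl // expn0.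
under [X in X + _]eq_bigr do rewrite mul1n.
rewrite IH ln_natM ?expn_gt0 ?p0 // addrC ln_natX //; congr (_ + _).
rewrite (eq_bigr (fun=> ln p%:R)) => [|j _].
  by rewrite sumr_const_nat subn0 mulr_natl.
rewrite (bigD1_seq 1%N) ?divisor1 ?divisors_uniq //=.
rewrite vonMangoldt_pfactor ?coprimen1 // eqxx big1_seq ?addr0 //.
move=> e /andP[e1]; rewrite -dvdn_divisors // => em.
by rewrite vonMangoldt_pfactor ?(dvdn_gt0 m0 em) ?(coprime_dvdr em cpm) ?(negbTE e1).
Qed.

Definition mobius n : R :=
  \prod_(p <- primes n) (if logn p n == 1%N then -1 else 0).

Lemma mobius1 : mobius 1 = 1.
Proof. by rewrite /mobius big_nil. Qed.

Lemma normr_mobius n : `|mobius n| <= 1.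
Proof.
rewrite /mobius; elim/big_ind: _ => [||p _]; first by rewrite normr1.
  by move=> x y hx hy; rewrite normrM mulr_ile1.
by case: ifP; rewrite ?normrN ?normr1 ?normr0 ?ler01.
Qed.

Lemma mobius_pfactor p k m : prime p -> (0 < k)%N -> (0 < m)%N ->
  coprime p m -> mobius (p ^ k * m) = if k == 1%N then - mobius m else 0.
Proof.
move=> pp k0 m0 cpm; rewrite /mobius (perm_big _ (primes_pfactor pp k0 m0 cpm)).
rewrite big_cons /= lognM ?expn_gt0 ?(prime_gt0 pp) // pfactorK //.
rewrite logn_coprime // addn0; case: ifP => _; last by rewrite mul0r.
rewrite mulN1r; congr (- _); apply: eq_big_seq => q.
rewrite mem_primes => /and3P[pq _ qm].
rewrite lognM ?expn_gt0 ?(prime_gt0 pp) // lognX logn_prime //.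
case: (q =P p) => [qp|_]; last by rewrite muln0.
by move: cpm; rewrite -qp prime_coprime // qm.
Qed.

(** Only the exponents 0 and 1 of [p] survive, with opposite signs. The difference on the right
    vanishes for constant [G] and is [- ln p] for [G = ln], so the next two identities need a case
    split rather than an induction hypothesis. *)
Lemma sum_mobius_pfactor (G : nat -> R) p k m : prime p -> (0 < k)%N ->
  (0 < m)%N -> coprime p m ->
  \sum_(d <- divisors (p ^ k * m)) mobius d * G d
  = \sum_(e <- divisors m) mobius e * (G e - G (p * e)%N).
Proof.
move=> pp k0 m0 cpm; case: k k0 => // k _.
rewrite sum_divisors_pfactor // !big_nat_recl // [X in _ + (_ + X)]big1 ?addr0.
  rewrite -big_split /=; apply: eq_big_seq => e; rewrite -dvdn_divisors // => em.
  rewrite expn0 mul1n mobius_pfactor ?(dvdn_gt0 m0 em) ?(coprime_dvdr em cpm) //=.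
  by rewrite expn1; ring.
move=> j _; apply: big1_seq => e /andP[_]; rewrite -dvdn_divisors // => em.
by rewrite mobius_pfactor ?(dvdn_gt0 m0 em) ?(coprime_dvdr em cpm) //= mul0r.
Qed.

Lemma sum_mobius n : (0 < n)%N ->
  \sum_(d <- divisors n) mobius d = (n == 1%N)%:R.
Proof.
move=> n0; under eq_bigr do rewrite -[mobius _]mulr1.
elim/pfactor_ind: n / n0.
  by rewrite big_cons big_nil mobius1 mulr1 addr0.
move=> p k m pp k0 m0 cpm _.
rewrite (sum_mobius_pfactor (fun=> 1)) // subrr; under eq_bigr do rewrite mulr0.
rewrite big1 // muln_eq1 (gtn_eqF (_ : 1 < p ^ k)%N) //.
by rewrite -{1}(expn0 p) ltn_exp2l ?prime_gt1.
Qed.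

Lemma sum_mobius_ln n : (0 < n)%N ->
  \sum_(d <- divisors n) mobius d * ln d%:R = - vonMangoldt n.
Proof.
move=> n0; elim/pfactor_ind: n / n0.
  by rewrite big_cons big_nil ln1 vonMangoldt1 mulr0 addr0 oppr0.
move=> p k m pp k0 m0 cpm _; rewrite (sum_mobius_pfactor (fun d => ln d%:R)) //.
rewrite vonMangoldt_pfactor //.
transitivity (\sum_(e <- divisors m) mobius e * - ln p%:R).
  apply: eq_big_seq => e; rewrite -dvdn_divisors // => em.
  by rewrite (ln_natM (prime_gt0 pp) (dvdn_gt0 m0 em)); ring.
rewrite -mulr_suml sum_mobius //.
by case: (m == 1%N); rewrite ?mul1r // mul0r oppr0.
Qed.

(** * Divisor sums of a real character *)

Section RealCharacter.
Variable chi : nat -> R.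
Hypothesis chi1 : chi 1%N = 1.
Hypothesis chiM : forall m n, chi (m * n)%N = chi m * chi n.
Hypothesis chi_sign : forall n, [|| chi n == 1, chi n == 0 | chi n == -1].

Lemma chiX m k : chi (m ^ k)%N = chi m ^+ k.
Proof. by elim: k => [|k IH]; rewrite ?expn0 // expnS exprS chiM IH. Qed.

Lemma sum_char_pfactor p k m : prime p -> (0 < m)%N -> coprime p m ->
  \sum_(d <- divisors (p ^ k * m)) chi d
  = (\sum_(0 <= j < k.+1) chi p ^+ j) * \sum_(d <- divisors m) chi d.
Proof.
move=> pp m0 cpm; rewrite sum_divisors_pfactor // mulr_suml.
apply: eq_bigr => j _; rewrite mulr_sumr; apply: eq_bigr => e _.
by rewrite chiM chiX.
Qed.

(** The sum is [k + 1], 1, or the indicator of even [k], according as [chi p] is 1, 0 or -1. *)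
Lemma sum_sign_geom p k :
  0 <= \sum_(0 <= j < k.+1) chi p ^+ j /\
  (~~ odd k -> 1 <= \sum_(0 <= j < k.+1) chi p ^+ j).
Proof.
have geo (x : R) : \sum_(0 <= j < k.+1) x ^+ j = 1 + \sum_(0 <= j < k) x ^+ j.+1.
  by rewrite big_nat_recl // expr0.
case/or3P: (chi_sign p) => /eqP ->.
- under eq_bigr do rewrite expr1n.
  by rewrite sumr_const_nat subn0 ler0n ler1n.
- rewrite geo big1 ?addr0 ?ler01 ?lexx // => j _.
  by rewrite exprS mul0r.
- have -> : \sum_(0 <= j < k.+1) (-1) ^+ j = (~~ odd k)%:R :> R.
    elim: k {geo} => [|k IH]; first by rewrite big_nat1.
    rewrite big_nat_recr //= IH exprS -signr_odd.
    by case: (odd k) => /=; rewrite ?expr0 ?expr1; ring.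
  by split=> [|->]; rewrite ?ler0n.
Qed.

Lemma sum_char_ge0 n : (0 < n)%N -> 0 <= \sum_(d <- divisors n) chi d.
Proof.
move=> n0; elim/pfactor_ind: n / n0.
  by rewrite big_cons big_nil chi1 addr0.
move=> p k m pp k0 m0 cpm IH; rewrite sum_char_pfactor // mulr_ge0 //.
exact: (sum_sign_geom p k).1.
Qed.

(** All exponents in a square are even, so every local factor is at least 1. The squares later force
    a Lambert series to be large. *)
Lemma sum_char_square n : (0 < n)%N -> 1 <= \sum_(d <- divisors (n ^ 2)) chi d.
Proof.
move=> n0; elim/pfactor_ind: n / n0.
  by rewrite big_cons big_nil chi1 addr0.
move=> p k m pp k0 m0 cpm IH; rewrite expnMn -expnM sum_char_pfactor //.
- apply: mulr_ege1 => //; apply: (sum_sign_geom p _).2.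
  by rewrite oddM andbF.
- by rewrite expn_gt0 m0.
- exact: coprimeXr.
Qed.

End RealCharacter.
End ArithmeticFunctions.

(** * Chebyshev and Mertens estimates *)

Section Mertens.
Variable R : realType.
Implicit Types n p k m N : nat.

Local Notation lnn n := (ln (n%:R : R)).
Local Notation Lambda := (@vonMangoldt R).

Lemma lnn_ge0 n : 0 <= lnn n.
Proof. by case: n => [|n]; [rewrite ln0 | apply: ln_ge0; rewrite ler1n]. Qed.

Lemma le_lnn m n : (0 < m)%N -> (m <= n)%N -> lnn m <= lnn n.
Proof. by move=> m0 mn; rewrite ler_ln ?posrE ?ltr0n ?ler_nat //; lia. Qed.

Lemma lnn_step_le n : (0 < n)%N -> lnn n.+1 - lnn n <= n%:R^-1.
Proof.
move=> n0; have n0' : 0 < n%:R :> R by rewrite ltr0n.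
rewrite -ln_div ?posrE ?ltr0n // -natr1 mulrDl divff ?gt_eqF // mul1r.
by apply: le_ln1Dx; rewrite (lt_trans (ltrN10 _)) // invr_gt0.
Qed.

Lemma lnn_step_ge n : (0 < n)%N -> n.+1%:R^-1 <= lnn n.+1 - lnn n.
Proof.
move=> n0; have n0' : 0 < n%:R :> R by rewrite ltr0n.
have n1 : 0 < n.+1%:R :> R by rewrite ltr0n.
rewrite -lerN2 opprB -ln_div ?posrE //.
have -> : n%:R / n.+1%:R = 1 + - n.+1%:R^-1 :> R.
  by rewrite -(natr1 n); field; lra.
apply: le_ln1Dx; rewrite ltrN2 invf_lt1 // ltr1n; lia.
Qed.

Lemma sum_lnn_ge N :
  N%:R * lnn N - N%:R <= \sum_(1 <= n < N.+1) lnn n.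
Proof.
elim: N => [|N IH]; first by rewrite big_geq // mul0r subr0.
rewrite big_nat_recr //=; case: N IH => [|N] IH.
  by rewrite big_geq // ln1; lra.
apply: le_trans (lerD IH (lexx _)).
have := lnn_step_le (ltn0Sn N); rewrite -(natr1 N.+1).
have N0 : 0 < N.+1%:R :> R by rewrite ltr0n.
move=> /(ler_wpM2l (ltW N0)); rewrite mulfV ?gt_eqF //.
by lra.
Qed.

Lemma sum_lnn_le N : \sum_(1 <= n < N.+1) lnn n <= N%:R * lnn N.
Proof.
rewrite -[N in N%:R](subn1 N.+1) mulr_natl -sumr_const_nat.
by apply: ler_sum_nat => n nN; apply: le_lnn; lia.
Qed.

(** Legendre's formula for the factorisation of [N!], in logarithmic form. *)
Lemma sum_lnn N : \sum_(1 <= n < N.+1) lnn n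
  = \sum_(1 <= d < N.+1) Lambda d * (N %/ d)%:R.
Proof.
transitivity (\sum_(1 <= n < N.+1) \sum_(d <- divisors n) Lambda d).
  by apply: eq_big_nat => n nN; rewrite sum_vonMangoldt //; lia.
rewrite (sum_divisors_hyperbola (fun d _ => Lambda d)).
apply: eq_bigr => d _; rewrite sumr_const_nat.
by rewrite subSS subn0 mulr_natr.
Qed.

Lemma ln2_le1 : ln 2 <= 1 :> R.
Proof.
by have := @lnn_step_le 1 isT; rewrite mulr1n ln1 subr0 invr1.
Qed.

(** The left side is the logarithm of the central binomial coefficient; passing from [n] to [n + 1]
    adds at most [2 ln 2], hence at most 2. *)
Lemma sum_lnn_double n :
  \sum_(1 <= m < n.*2.+1) lnn m - 2 * \sum_(1 <= m < n.+1) lnn m <= n.*2%:R.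
Proof.
elim: n => [|n IH]; first by rewrite !big_geq // mulr0 subrr.
rewrite doubleS !(big_nat_recr n.*2.+2) ?(big_nat_recr n.*2.+1) //=.
rewrite (big_nat_recr n.+1) //=.
have e2 : lnn n.*2.+2 = ln 2 + lnn n.+1 by rewrite -ln_natM // mul2n.
have l1 : lnn n.*2.+1 <= lnn n.*2.+2 by apply: le_lnn.
have l2 := ln2_le1; have E : n.*2.+2%:R = n.*2%:R + 2 :> R by rewrite -natrD addn2.
by rewrite [leRHS]E; lra.
Qed.

Definition psi N : R := \sum_(1 <= d < N.+1) Lambda d.

(** Chebyshev's argument: in the logarithm of the central binomial coefficient, [Lambda d] has the
    coefficient [2n %/ d - 2 (n %/ d)], which is never negative and is at least 1 for
    [n < d <= 2n]. *)
Lemma psi_double n : psi n.*2 <= psi n + n.*2%:R.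
Proof.
have le2 : (n.+1 <= n.*2.+1)%N by lia.
rewrite /psi (big_cat_nat (n := n.+1)) //= lerD2l.
apply: le_trans (sum_lnn_double n); rewrite !sum_lnn mulr_sumr.
have -> : \sum_(1 <= d < n.+1) 2 * (Lambda d * (n %/ d)%:R) =
          \sum_(1 <= d < n.*2.+1) 2 * (Lambda d * (n %/ d)%:R).
  rewrite [RHS](big_cat_nat (n := n.+1)) //= [X in _ + X]big1_seq ?addr0 // => d.
  by case/andP=> _; rewrite mem_index_iota => nd; rewrite divn_small ?mulr0 //; lia.
rewrite -sumrB.
apply: le_trans (_ : \sum_(n.+1 <= d < n.*2.+1)
  (Lambda d * (n.*2 %/ d)%:R - 2 * (Lambda d * (n %/ d)%:R)) <= _).
  apply: ler_sum_nat => d nd; rewrite (divn_small (m := n)); last by lia.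
  rewrite mulr0n !mulr0 subr0 ler_peMr ?vonMangoldt_ge0 // ler1n divn_gt0; lia.
rewrite [leRHS](big_cat_nat (n := n.+1)) //= lerDr.
apply: sumr_ge0 => d _.
rewrite (_ : _ - _ = Lambda d * ((n.*2 %/ d)%:R - 2 * (n %/ d)%:R)); last by ring.
rewrite mulr_ge0 ?vonMangoldt_ge0 // subr_ge0 -natrM ler_nat.
case: d => [|d]; first by rewrite !divn0.
by rewrite leq_divRL // -mul2n -mulnA leq_mul2l /= leq_divM.
Qed.

Lemma psi_le N : psi N <= 4 * N%:R.
Proof.
have [b] := ubnP N; elim: b N => // b IH N Nb.
have mono m n : (m <= n)%N -> psi m <= psi n.
  move=> mn; rewrite /psi (big_cat_nat (n := m.+1) (p := n.+1)) //= lerDl.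
  by apply: sumr_ge0 => d _; apply: vonMangoldt_ge0.
have [N1|N1] := leqP N 1.
  case: N N1 {Nb} => [|[|//]] _; rewrite /psi; first by rewrite big_geq ?mulr0.
  by rewrite big_nat1 vonMangoldt1 mulr_ge0.
have := psi_double (uphalf N); have := mono N (uphalf N).*2 ltac:(lia).
have := IH (uphalf N) ltac:(lia).
(* Equality holds at [N = 3], which fixes the constant 4. *)
have : (4 * uphalf N + (uphalf N).*2 <= 4 * N)%N by lia.
rewrite -(ler_nat R) natrD !natrM; lra.
Qed.

(** Mertens' theorem. Replacing [N %/ d] by [N / d] in Legendre's formula costs at most
    [psi N <= 4 N], and [ln N!] lies between [N ln N - N] and [N ln N]. *)
Lemma sum_vonMangoldt_div N : (0 < N)%N ->
  `|\sum_(1 <= d < N.+1) Lambda d / d%:R - lnn N| <= 4.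
Proof.
move=> N0; have N0' : 0 < N%:R :> R by rewrite ltr0n.
have lower := sum_lnn_ge N; have upper := sum_lnn_le N.
rewrite sum_lnn in lower upper; have ps := psi_le N.
set S := \sum_(1 <= d < N.+1) _ / _.
have S1 : \sum_(1 <= d < N.+1) Lambda d * (N %/ d)%:R <= N%:R * S.
  rewrite mulr_sumr; apply: ler_sum_nat => d dN.
  rewrite mulrCA ler_wpM2l ?vonMangoldt_ge0 // ler_pdivlMr ?ltr0n; last by lia.
  by rewrite -natrM ler_nat leq_divM.
have S2 : N%:R * S <= \sum_(1 <= d < N.+1) Lambda d * (N %/ d)%:R + psi N.
  rewrite mulr_sumr /psi -big_split /=; apply: ler_sum_nat => d dN.
  rewrite mulrCA -[X in _ <= _ + X]mulr1 -mulrDr ler_wpM2l ?vonMangoldt_ge0 //.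
  rewrite ler_pdivrMr ?ltr0n; last by lia.
  by rewrite natr1 -natrM ler_nat ltnW // ltn_ceil //; lia.
rewrite ler_norml; apply/andP; split.
  rewrite -(ler_pM2l N0'); lra.
rewrite -(ler_pM2l N0'); lra.
Qed.

Lemma sum_geom_sq_le (p K : nat) : (1 < p)%N ->
  \sum_(2 <= k < K) (p%:R ^+ k)^-1 <= (p%:R * (p%:R - 1))^-1 :> R.
Proof.
move=> p1; have p0 : 1 < p%:R :> R by rewrite ltr1n.
have [K2|K2] := leqP K 2.
  by rewrite big_geq // invr_ge0 mulr_ge0; lra.
have -> : K = (K - 2 + 2)%N by lia.
(* Adding the closed form of the tail turns the bound into an identity. *)
have : \sum_(2 <= k < K - 2 + 2) (p%:R ^+ k)^-1 + (p%:R ^+ (K - 2).+1 * (p%:R - 1))^-1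
    = (p%:R * (p%:R - 1))^-1 :> R.
  elim: (K - 2)%N => [|n IH]; first by rewrite big_geq // add0r expr1.
  rewrite -IH addSn big_nat_recr ?leq_addl //= -addrA; congr (_ + _).
  rewrite addn2 !exprS; field.
  by rewrite expf_neq0 /=; lra.
move=> <-; rewrite lerDl invr_ge0 mulr_ge0 ?exprn_ge0; lra.
Qed.

(** The function [(ln x + 2) / x] has derivative [- (ln x + 1) / x ^ 2], so its decrements majorise
    the terms on the left. Its value at 1 is the constant 2 of the next lemma. *)
Lemma lnn_div_telescope q : (0 < q)%N ->
  lnn q.+1 * (q.+1%:R * (q.+1%:R - 1))^-1
  <= (lnn q + 2) / q%:R - (lnn q.+1 + 2) / q.+1%:R.
Proof.
move=> q0; have := lnn_step_le q0; rewrite -(natr1 q) addrK.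
set a := ln q%:R; set b := ln _; set x := q%:R.
have x1 : 1 <= x by rewrite /x ler1n.
move=> h; rewrite -subr_ge0.
have -> : (a + 2) / x - (b + 2) / (x + 1) - b * ((x + 1) * x)^-1
   = ((x + 1) * (x^-1 - (b - a)) + (1 - x^-1)) / ((x + 1) * x).
  by field; lra.
have xi : x^-1 <= 1 by rewrite invf_le1 //; lra.
apply: divr_ge0; last by apply: mulr_ge0; lra.
by apply: addr_ge0; [apply: mulr_ge0|]; lra.
Qed.

(** Only powers [p ^ k] with [k >= 2] contribute. Enlarging the range of [p] to all integers from 2
    on, the sum over [k] is geometric and the sum over [p] is bounded by a telescoping one. *)
Lemma sum_vonMangoldt_nonprime N :
  \sum_(1 <= n < N.+1 | ~~ prime n) Lambda n / n%:R <= 2.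
Proof.
pose c p k : R := lnn p * (p%:R ^+ k)^-1.
have c0 p k : 0 <= c p k by rewrite mulr_ge0 ?lnn_ge0 // invr_ge0 exprn_ge0.
have term n : (1 <= n < N.+1)%N -> ~~ prime n -> Lambda n / n%:R
    <= \sum_(2 <= p < N.+1) \sum_(2 <= k < N.+1) (p ^ k == n)%N%:R * c p k.
  move=> nN npr.
  have ge0 : 0 <= \sum_(2 <= p < N.+1) \sum_(2 <= k < N.+1) (p ^ k == n)%N%:R * c p k.
    by apply: sumr_ge0 => p _; apply: sumr_ge0 => k _; rewrite mulr_ge0.
  rewrite /vonMangoldt; case e: (primes n) => [|p [|? ?]]; rewrite ?mul0r //.
  have : p \in primes n by rewrite e inE.
  rewrite mem_primes => /and3P[pp _ pn]; have p1 := prime_gt1 pp.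
  have en : n = (p ^ logn p n)%N.
    have [m cpm nm] := pfactor_coprime pp (ltac:(lia) : (0 < n)%N).
    have m0 : (0 < m)%N by case: m nm {cpm} => [|//]; lia.
    suff m1 : m = 1%N by rewrite {1}nm m1 mul1n.
    apply/eqP; rewrite eqn_leq m0 andbT leqNgt; apply/negP => m1.
    have : pdiv m \in primes n.
      rewrite mem_primes pdiv_prime //= nm dvdn_mulr ?pdiv_dvd // andbT.
      by rewrite -nm; lia.
    rewrite e inE => /eqP epm; move: cpm.
    by rewrite prime_coprime // -epm pdiv_dvd.
  have k2 : (1 < logn p n)%N.
    case: (logn p n) en => [|[|//]] en; first by rewrite en in e.
    by rewrite en expn1 pp in npr.
  have kN : (logn p n < N.+1)%N.
    by have := ltn_expl (logn p n) p1; rewrite -en; lia.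
  have pN : (p < N.+1)%N by have := dvdn_leq (ltac:(lia) : (0 < n)%N) pn; lia.
  rewrite (bigD1_seq p) ?iota_uniq ?mem_index_iota ?p1 //=.
  rewrite (bigD1_seq (logn p n)) ?iota_uniq ?mem_index_iota ?k2 //=.
  rewrite -en eqxx mul1r /c -natrX -en -addrA lerDl addr_ge0 //.
    by apply: sumr_ge0 => k _; rewrite mulr_ge0 //; apply: c0.
  apply: sumr_ge0 => q _; apply: sumr_ge0 => k _.
  by rewrite mulr_ge0 //; apply: c0.
apply: le_trans (_ : \sum_(1 <= n < N.+1) \sum_(2 <= p < N.+1)
   \sum_(2 <= k < N.+1) (p ^ k == n)%N%:R * c p k <= _).
  rewrite big_mkcond; apply: ler_sum_nat => n nN; case: ifP => npr.
    exact: term.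
  by apply: sumr_ge0 => p _; apply: sumr_ge0 => k _; rewrite mulr_ge0.
rewrite exchange_big /=.
apply: le_trans (_ : \sum_(2 <= p < N.+1) \sum_(2 <= k < N.+1) c p k <= _).
  apply: ler_sum => p _; rewrite exchange_big /=; apply: ler_sum => k _.
  rewrite -mulr_suml -[leRHS]mul1r ler_wpM2r //.
  have [kN|kN] := boolP ((p ^ k)%N \in index_iota 1 N.+1).
    rewrite (bigD1_seq (p ^ k)%N) ?iota_uniq //= eqxx big1 ?addr0 //.
    by move=> n; rewrite eq_sym => /negbTE ->.
  rewrite big1_seq ?ler01 // => n /andP[_ nN].
  by case: eqP => // e; rewrite e nN in kN.
have le3 p : (2 <= p < N.+1)%N -> \sum_(2 <= k < N.+1) c p k
   <= lnn p * (p%:R * (p%:R - 1))^-1.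
  by move=> pN; rewrite -mulr_sumr ler_wpM2l ?lnn_ge0 // sum_geom_sq_le //; lia.
apply: le_trans (ler_sum_nat le3) _; rewrite big_add1 /=.
have le4 q : (1 <= q < N)%N -> lnn q.+1 * (q.+1%:R * (q.+1%:R - 1))^-1
   <= (- ((lnn q.+1 + 2) / q.+1%:R)) - (- ((lnn q + 2) / q%:R)).
  by move=> qN; rewrite opprK [leRHS]addrC lnn_div_telescope //; lia.
apply: le_trans (ler_sum_nat le4) _.
have [N0|N0] := leqP N 0; first by rewrite big_geq //; lia.
rewrite (telescope_sumr (fun q => - ((lnn q + 2) / q%:R))) //.
rewrite mulr1n ln1 divr1 opprK add0r gerDr oppr_le0 divr_ge0 //.
by rewrite addr_ge0 ?lnn_ge0.
Qed.

End Mertens.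

(** * Characters modulo M *)

Lemma exists_primitive_root (F : numClosedFieldType) (n : nat) :
  (0 < n)%N -> exists z : F, n.-primitive_root z.
Proof.
move=> n0; have [r] := closed_field_poly_normal ('X^n - 1 : {poly F}).
rewrite lead_coefXnsubC // scale1r => split_r.
have /hasP[z _ pz] : has n.-primitive_root r; last by exists z.
apply: has_prim_root => //.
- by apply/allP => z; rewrite -root_prod_XsubC -split_r.
- by rewrite -separable_prod_XsubC -split_r separable_Xn_sub_1 // pnatr_eq0; lia.
- by rewrite -ltnS -(size_prod_XsubC r id) -split_r size_XnsubC.
Qed.

(** Irreducible characters take values in [algC], whereas the analysis takes place over [R[i]].
    Matching the powers of two primitive roots identifies the roots of unity of both fields. *)
Lemma transfer_unity_roots (K F : numClosedFieldType) (n : nat) : (0 < n)%N ->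
  exists tau : K -> F, [/\ tau 1 = 1,
    forall x y, x ^+ n = 1 -> y ^+ n = 1 -> tau (x * y) = tau x * tau y,
    forall x, x ^+ n = 1 -> tau x ^+ n = 1 &
    forall x y, x ^+ n = 1 -> y ^+ n = 1 -> tau x = tau y -> x = y].
Proof.
move=> n0; have [z pz] := exists_primitive_root K n0.
have [w pw] := exists_primitive_root F n0.
pose tau x : F := if [pick i : 'I_n | x == z ^+ i] is Some i then w ^+ i else 0.
have tauX k : tau (z ^+ k) = w ^+ k.
  rewrite /tau; case: pickP => [i|].
    by rewrite (eq_prim_root_expr pz) -(eq_prim_root_expr pw) eq_sym => /eqP.
  have zk1 : (z ^+ k) ^+ n = 1 by rewrite exprAC (prim_expr_order pz) expr1n.
  have [j ej] := prim_rootP pz zk1.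
  by move/(_ j); rewrite ej eqxx.
exists tau; split.
- by rewrite -(expr0 z) tauX.
- move=> x y /(prim_rootP pz)[i ->] /(prim_rootP pz)[j ->].
  by rewrite -exprD !tauX exprD.
- move=> x /(prim_rootP pz)[i ->]; rewrite tauX.
  by rewrite exprAC (prim_expr_order pw) expr1n.
- move=> x y /(prim_rootP pz)[i ->] /(prim_rootP pz)[j ->]; rewrite !tauX.
  move/eqP; rewrite (eq_prim_root_expr pw) -(eq_prim_root_expr pz).
  by move/eqP.
Qed.

Lemma abelian_characters (F : numClosedFieldType) (gT : finGroupType)
    (G : {group gT}) : abelian G ->
  exists chi : Iirr G -> gT -> F,
    [/\ [/\ forall i, {in G &, {morph chi i : x y / (x * y)%g >-> x * y}},
            forall i x, x \in G -> chi i x ^+ #|G| = 1 &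
            forall x, x \in G -> chi 0 x = 1],
        forall i, i != 0 -> exists2 x, x \in G & chi i x != 1,
        forall i, exists j, forall x, x \in G -> chi j x = (chi i x)^-1,
        forall i j, {in G, chi i =1 chi j} -> i = j &
        forall x, x \in G -> x != 1%g -> \sum_i chi i x = 0].
Proof.
move=> /char_abelianP lin.
have [tau [tau1 tauM tauX tau_inj]] :=
  transfer_unity_roots algC F (cardG_gt0 G).
have root1 i x : x \in G -> 'chi[G]_i x ^+ #|G| = 1.
  by move=> xG; rewrite -lin_charX // expg_cardG // lin_char1.
pose chi i x := tau ('chi[G]_i x); exists chi.
have eq1 i x : x \in G -> chi i x = 1 -> 'chi_i x = 1.
  by move=> xG e; apply: tau_inj; rewrite ?root1 ?expr1n ?tau1.
split; [split|..].
- by move=> i x y xG yG; rewrite /chi lin_charM // tauM ?root1.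
- by move=> i x xG; rewrite tauX ?root1.
- by move=> x xG; rewrite /chi irr0 cfun1E xG tau1.
- move=> i; rewrite -subGcfker => /subsetPn[x xG].
  rewrite cfkerEirr inE lin_char1 // => x1; exists x => //.
  by apply: contra x1 => /eqP/(eq1 i x xG) ->.
- move=> i; exists (conjC_Iirr i) => x xG.
  have chi0 : chi i x != 0.
    apply: contra_eqN (tauX _ (root1 i x xG)) => /eqP e.
    by rewrite -/(chi i x) e expr0n gtn_eqF ?cardG_gt0 // eq_sym oner_eq0.
  have conjE : 'chi_(conjC_Iirr i) x = 'chi_i x^-1%g.
    by rewrite lin_charV_conj // conjC_IirrE cfunE.
  apply: (mulfI chi0); rewrite divff // /chi conjE.
  by rewrite -tauM ?root1 ?groupV // -lin_charM ?groupV // mulgV lin_char1.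
- move=> i j e; apply: irr_inj; apply/cfun_inP => x xG.
  by apply: tau_inj; rewrite ?root1 //; apply: e.
(* The kernels of the irreducible characters intersect trivially, so some [chi j x] is not 1.
   Multiplication by that character permutes all of them, hence the sum equals [chi j x] times
   itself. *)
- move=> x xG x1; have [j j1] : exists j, 'chi[G]_j x != 1.
    apply/existsP; apply: contraNT x1; rewrite negb_exists => /forallP no.
    rewrite -finset.in_set1 -set1gE -(TI_cfker_irr G); apply/bigcapP => j _.
    by rewrite cfkerEirr inE lin_char1 //; apply: negbNE (no j).
  pose h i := cfIirr ('chi[G]_j * 'chi_i).
  have hE i : 'chi_(h i) = 'chi_j * 'chi_i by rewrite cfIirrE // mul_lin_irr ?mem_irr.
  have h_inj : injective h.
    move=> i k e; apply: irr_inj; apply: (mulrI (lin_char_unitr (lin j))).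
    by rewrite -!hE e.
  have e : \sum_i chi i x = chi j x * \sum_i chi i x.
    rewrite [LHS](reindex_inj h_inj) mulr_sumr /=; apply: eq_bigr => i _.
    by rewrite /chi hE cfunE tauM ?root1.
  have : (chi j x - 1) * \sum_i chi i x = 0 by rewrite mulrBl mul1r -e subrr.
  move/eqP; rewrite mulf_eq0 => /orP[|/eqP //].
  by rewrite subr_eq0 => /eqP/(eq1 j x xG)/eqP; rewrite (negbTE j1).
Qed.

(** Multiplication by a unit permutes the residues modulo [M]. *)
Lemma sum_period_mulr (V : nmodType) (f : nat -> V) (M a : nat) :
  (0 < M)%N -> (forall n, f (n + M)%N = f n) -> coprime M a ->
  \sum_(0 <= n < M) f (a * n)%N = \sum_(0 <= n < M) f n.
Proof.
move=> M0 per cop; have fmod n : f (n %% M)%N = f n.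
  rewrite [in RHS](divn_eq n M) addnC; elim: (n %/ M)%N => [|q IH].
    by rewrite addn0.
  by rewrite mulSnr addnA per.
under eq_bigr do rewrite -fmod.
rewrite -(big_map (fun n => a * n %% M)%N xpredT f); apply: perm_big.
set s := map _ _; have sub : {subset s <= index_iota 0 M}.
  by move=> _ /mapP[n _ ->]; rewrite mem_index_iota ltn_pmod.
have us : uniq s.
  rewrite map_inj_in_uniq ?iota_uniq // => x y; rewrite !mem_index_iota => xM yM.
  move/eqP; wlog xy : x y xM yM / (x <= y)%N.
    move=> W; have [|/ltnW] := leqP x y; first exact: W.
    by rewrite eq_sym => yx e; apply/esym; apply: W.
  rewrite eq_sym eqn_mod_dvd ?leq_mul // -mulnBr Gauss_dvdr // => dv.
  by move: dv; case: (posnP (y - x)) => [|p /dvdn_leq]; lia.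
apply: uniq_perm => //; first exact: iota_uniq.
by apply: (uniq_min_size us sub _).2; rewrite size_map.
Qed.

(** * Dirichlet characters with complex values *)

Section DirichletCharacters.
Local Open Scope complex_scope.
Variable R : rcfType.
Local Notation C := R[i].
Local Notation nrm := (@Normc.normc R).

Lemma unity_root_conj (z : C) n : (0 < n)%N -> z ^+ n = 1 ->
  nrm z = 1 /\ z^*%C = z^-1.
Proof.
move=> n0 zn; have z1 : `|z| = 1.
  by apply/eqP; rewrite -(pexpr_eq1 n0) ?normr_ge0 // -normrX zn normr1.
have zn1 : nrm z = 1 by move: z1 => [].
have z0 : z != 0 by rewrite -normr_gt0 z1 ltr01.
split=> //; apply: (mulfI z0); rewrite divff //.
by rewrite -sqr_normc z1 expr1n.
Qed.

(** These are the characters of the unit group of ['Z_M], extended by 0. The clause on conjugates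
    lets a character whose conjugate has another index be told apart from it by a value. *)
Lemma dirichlet_characters (M : nat) : (1 < M)%N ->
  exists (I : finType) (chi : I -> nat -> C) (i0 : I),
    [/\ forall i, [/\ chi i 1%N = 1,
          forall m n, chi i (m * n)%N = chi i m * chi i n,
          forall n, nrm (chi i n) = (coprime M n)%:R &
          forall n, chi i (n + M)%N = chi i n],
        forall n, chi i0 n = (coprime M n)%:R,
        forall i, i != i0 -> \sum_(0 <= n < M) chi i n = 0,
        forall i, exists2 j, forall n, chi j n = (chi i n)^*%C &
                             (i = j \/ exists n, chi j n != chi i n) &
        forall a n, coprime M a ->
          \sum_i (chi i a)^*%C * chi i n = if n == a %[mod M] then #|I|%:R else 0].
Proof.
move=> M1; pose G := [set: {unit 'Z_M}]%G.
have M0 : (0 < M)%N by lia.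
have [psi [[psiM psiX psi0] psi_nontriv psi_conj psi_inj psi_orth]] :=
  abelian_characters C (units_Zp_abelian M : abelian G).
(* The default 1 is taken when [n] is not prime to [M]; the test in [chi] hides it. *)
pose u n : {unit 'Z_M} := insubd (1%g : {unit 'Z_M}) (n%:R : 'Z_M).
have uE n : coprime M n -> val (u n) = n%:R.
  by move=> cop; rewrite insubdK // unitZpE.
have uM m n : coprime M m -> coprime M n -> u (m * n)%N = (u m * u n)%g.
  move=> cm cn; apply: val_inj.
  by rewrite /= uE ?coprimeMr ?cm // !uE // natrM.
have u_eq m n : coprime M m -> coprime M n -> (u m == u n) = (m == n %[mod M]).
  move=> cm cn; rewrite -val_eqE !uE // -val_eqE /= !val_Zp_nat //.
have u_surj x : exists2 n, coprime M n & u n = x.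
  exists (val x : 'Z_M) => //.
    by rewrite -unitZpE // natr_Zp (valP x).
  by apply: val_inj; rewrite uE ?natr_Zp // -unitZpE // natr_Zp (valP x).
have inG x : x \in G by rewrite inE.
pose chi i n : C := if coprime M n then psi i (u n) else 0.
have e0 : (0 < #|G|)%N := cardG_gt0 G.
have conj_psi i x := unity_root_conj e0 (psiX i x (inG x)).
have psi1 i : psi i 1%g = 1.
  have := psiM i 1%g 1%g (inG _) (inG _); rewrite mulg1 => /esym/eqP.
  rewrite -subr_eq0 -{3}[psi i _]mulr1 -mulrBr mulf_eq0 subr_eq0.
  case/orP=> /eqP e //; have := (conj_psi i 1%g).1.
  by rewrite e Normc.normc0 => /eqP; rewrite eq_sym oner_eq0.
have psiV i x : psi i x^-1%g = (psi i x)^-1.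
  have px0 : psi i x != 0.
    apply/eqP => e; have := (conj_psi i x).1.
    by rewrite e Normc.normc0 => /eqP; rewrite eq_sym oner_eq0.
  by apply: (mulfI px0); rewrite -psiM // mulgV psi1 divff.
have cop_per n : coprime M (n + M) = coprime M n.
  by rewrite /coprime gcdnDr.
have chiM i m n : chi i (m * n)%N = chi i m * chi i n.
  rewrite /chi coprimeMr; case cm: (coprime M m); last by rewrite mul0r.
  case cn: (coprime M n); last by rewrite mulr0.
  by rewrite uM // psiM.
have chi_per i n : chi i (n + M)%N = chi i n.
  rewrite /chi cop_per; case cn: (coprime M n) => //; congr psi; apply/eqP.
  by rewrite u_eq ?modnDr // cop_per.
exists (Iirr G), chi, 0; split.
- move=> i; split=> //.
  + rewrite /chi coprimen1; have -> : u 1%N = 1%g; last exact: psi1.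
    by apply: val_inj; rewrite uE ?coprimen1.
  + move=> n; rewrite /chi; case: (coprime M n); last exact: Normc.normc0.
    exact: (conj_psi i _).1.
- by move=> n; rewrite /chi; case: (coprime M n) => //; rewrite psi0.
- move=> i /psi_nontriv[x _]; have [a ca <-] := u_surj x => pa.
  have := sum_period_mulr M0 (chi_per i) ca; under eq_bigr do rewrite chiM.
  rewrite -mulr_sumr {1}/chi ca => e.
  have : (psi i (u a) - 1) * \sum_(0 <= n < M) chi i n = 0.
    by rewrite mulrBl mul1r e subrr.
  by move/eqP; rewrite mulf_eq0 subr_eq0 (negbTE pa) => /eqP.
- move=> i; have [j ej] := psi_conj i; exists j.
    move=> n; rewrite /chi; case: (coprime M n); last by rewrite conjc0.
    by rewrite ej // (conj_psi i _).2.
  have [|] := boolP [forall x, psi i x == psi j x].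
    by move/forallP=> e; left; apply: psi_inj => x _; apply/eqP.
  rewrite negb_forall => /existsP[x]; have [n cn <-] := u_surj x => ne.
  by right; exists n; rewrite /chi cn eq_sym.
- move=> a n ca; rewrite /chi ca; case cn: (coprime M n); last first.
    rewrite big1 => [|i _]; last by rewrite mulr0.
    case: eqP => // e; move: cn.
    by rewrite -coprime_modr e coprime_modr ca.
  under eq_bigr => i _ do rewrite (conj_psi i _).2 -psiV -psiM //.
  rewrite -u_eq // eq_sym; case: eqP => [->|ne].
    by under eq_bigr do rewrite mulVg psi1; rewrite sumr_const.
  by apply: psi_orth => //; apply/eqP => /(canRL (mulKVg _)); rewrite mulg1 => /esym.
Qed.

End DirichletCharacters.

(** * Character sums *)

Local Open Scope complex_scope.

Section Modulus.
Variable R : rcfType.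

Local Notation nrm := (@Normc.normc R).

Lemma nrm_ge0 z : 0 <= nrm z.
Proof. by case: z => a b; apply: sqrtr_ge0. Qed.

Lemma nrm0 : nrm 0 = 0. Proof. exact: Normc.normc0. Qed.

Lemma nrm1 : nrm 1 = 1. Proof. exact: Normc.normc1. Qed.

Lemma nrmR (x : R) : nrm x%:C = `|x|.
Proof. by rewrite /= expr0n /= addr0 sqrtr_sqr. Qed.

Lemma nrm_conj (z : R[i]) : nrm z^*%C = nrm z.
Proof. by case: z => a b; rewrite /= sqrrN. Qed.

Lemma nrm_sum (I : Type) (r : seq I) (P : pred I) (F : I -> R[i]) :
  nrm (\sum_(i <- r | P i) F i) <= \sum_(i <- r | P i) nrm (F i).
Proof.
elim/big_ind2: _ => [|x a y b xa yb|//]; first by rewrite nrm0.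
exact: le_trans (le_normcD _ _) (lerD xa yb).
Qed.

End Modulus.

Section CharacterSums.
Variable R : realType.
Local Notation C := R[i].
Local Notation nrm := (@Normc.normc R).
Local Notation lnn n := (ln (n%:R : R)).
Local Notation Lambda := (@vonMangoldt R).
Local Notation mu := (@mobius R).

Variables (M : nat) (chi : nat -> C).
Hypothesis M_gt0 : (0 < M)%N.
Hypothesis chi1 : chi 1%N = 1.
Hypothesis chiM : forall m n, chi (m * n)%N = chi m * chi n.
Hypothesis chi_le1 : forall n, nrm (chi n) <= 1.
Hypothesis chi_period : forall n, chi (n + M)%N = chi n.
Hypothesis chi_sum0 : \sum_(0 <= i < M) chi i = 0.

Lemma sum_char_period m : \sum_(m <= i < m + M) chi i = 0.
Proof.
elim: m => [|m IH] //.
rewrite addSn big_nat_recr /=; last by lia.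
by rewrite chi_period addrC -big_ltn //; lia.
Qed.

(** Full periods cancel, and what remains has at most [M] terms. *)
Lemma nrm_sum_char m n : nrm (\sum_(m <= i < n) chi i) <= M%:R.
Proof.
have [b] := ubnP (n - m); elim: b m => // b IH m nb.
have [nm|mn] := leqP n (m + M).
  apply: le_trans (nrm_sum _ _ _) _.
  apply: le_trans (ler_sum _ (fun i _ => chi_le1 i)) _.
  by rewrite sumr_const_nat ler_nat; lia.
rewrite (big_cat_nat (n := (m + M)%N)) ?leq_addr ?(ltnW mn) //=.
by rewrite sum_char_period add0r; apply: IH; lia.
Qed.

(** Summation by parts: the partial sums of [chi] are bounded by [M], and the decrements of [w]
    together with its last value add up to [w m]. *)
Lemma nrm_sum_char_abel (w : nat -> R) m n :
  (forall i, (m <= i)%N -> 0 <= w i) ->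
  (forall i, (m <= i)%N -> w i.+1 <= w i) ->
  nrm (\sum_(m <= i < n) chi i * (w i)%:C) <= M%:R * w m.
Proof.
move=> w0 wd; have [nm|mn] := leqP n m.
  by rewrite big_geq // nrm0 mulr_ge0 // w0.
pose T n := \sum_(m <= i < n) chi i.
have abel k : \sum_(m <= i < m + k) chi i * (w i)%:C =
    \sum_(m <= i < m + k) T i.+1 * (w i - w i.+1)%:C + T (m + k)%N * (w (m + k)%N)%:C.
  elim: k => [|k IH]; first by rewrite addn0 /T !big_geq // mul0r addr0.
  rewrite addnS !big_nat_recr ?leq_addr //= IH.
  have -> : T (m + k).+1 = T (m + k)%N + chi (m + k)%N.
    by rewrite /T big_nat_recr ?leq_addr.
  rewrite rmorphB /=; ring.
have -> : n = (m + (n - m))%N by lia.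
rewrite abel; apply: le_trans (le_normcD _ _) _.
have -> : M%:R * w m = \sum_(m <= i < m + (n - m)) M%:R * (w i - w i.+1)
    + M%:R * w (m + (n - m))%N.
  rewrite -mulr_sumr -mulrDr; congr (_ * _).
  rewrite (eq_bigr (fun i => - w i.+1 - - w i)).
    by rewrite (telescope_sumr (fun i => - w i)) ?leq_addr //; ring.
  by move=> i _; rewrite opprK addrC.
have bnd x y : 0 <= x -> nrm (T y * x%:C) <= M%:R * x.
  by move=> x0; rewrite Normc.normcM nrmR ger0_norm // ler_wpM2r ?nrm_sum_char.
apply: lerD; last by rewrite bnd // w0 ?leq_addr.
apply: le_trans (nrm_sum _ _ _) _.
apply: ler_sum_nat => i mi; rewrite bnd // subr_ge0 wd //; lia.
Qed.

Definition charL N : C := \sum_(1 <= n < N.+1) chi n * (n%:R^-1)%:C.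

Definition charS N : C := \sum_(1 <= n < N.+1) chi n * (Lambda n / n%:R)%:C.

Lemma nrm_charLB N N' : (N <= N')%N ->
  nrm (charL N' - charL N) <= M%:R / N.+1%:R.
Proof.
move=> NN; rewrite /charL (big_cat_nat (n := N.+1)) //= addrAC subrr add0r.
apply: (nrm_sum_char_abel (w := fun n => n%:R^-1)) => i Ni /=.
  by rewrite invr_ge0.
by rewrite lef_pV2 ?posrE ?ltr0n ?ler_nat //; lia.
Qed.

(* Stands in for the limit [L(1, chi)]: by [nrm_charLB] the partial sums either
   decay at the rate of their own tails or stay away from 0. *)
Lemma charL_dichotomy :
  (exists2 B : R, 0 <= B & forall N, nrm (charL N) <= B / N.+1%:R) \/
  (exists2 e : R, 0 < e & exists N0, forall N, (N0 <= N)%N -> e <= nrm (charL N)).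
Proof.
have [bad|/existsNP[N0 /negP]] :=
    pselect (forall N, nrm (charL N) <= (2 * M%:R) / N.+1%:R).
  by left; exists (2 * M%:R); rewrite ?mulr_ge0.
(* Beyond [N0] the partial sums move by at most [M / (N0 + 1)], half of what [charL N0] exceeds in
   modulus. *)
rewrite -ltNge => good; right; exists (M%:R / N0.+1%:R).
  by rewrite divr_gt0 ?ltr0n.
exists N0 => N NN; have := nrm_charLB NN.
have := le_normcD (charL N) (charL N0 - charL N); rewrite addrC subrK.
rewrite -[nrm (charL N0 - _)]normcN opprB; move: good; rewrite -mulrA.
by move: (M%:R / _) (nrm _) (nrm _) (nrm _) => q x y z; lra.
Qed.

Lemma nrm_sum_char_ln : exists B : R, forall N,
  nrm (\sum_(1 <= n < N.+1) chi n * (lnn n / n%:R)%:C) <= B.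
Proof.
(* The weight [ln n / n] decreases once [ln n >= 1]; from 4 on this follows from [ln 4 = 2 ln 2] and
   [ln 2 >= 1 / 2]. *)
exists (\sum_(1 <= n < 4) lnn n / n%:R + M%:R * (lnn 4 / 4)) => N.
have w0 n : 0 <= lnn n / n%:R by rewrite divr_ge0 ?lnn_ge0.
have bnd k : nrm (\sum_(1 <= n < k) chi n * (lnn n / n%:R)%:C)
    <= \sum_(1 <= n < k) lnn n / n%:R.
  apply: le_trans (nrm_sum _ _ _) _; apply: ler_sum => n _.
  rewrite Normc.normcM nrmR ger0_norm // -[leRHS]mul1r ler_wpM2r //.
have [N4|N4] := leqP N.+1 4.
  apply: le_trans (bnd _) _; rewrite [in leRHS](big_cat_nat (n := N.+1)) //=.
  rewrite -addrA lerDl; apply: addr_ge0; first by apply: sumr_ge0.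
  by apply: mulr_ge0 => //; apply: (w0 4).
rewrite (big_cat_nat (n := 4)) 1?ltnW //=.
apply: le_trans (le_normcD _ _) (lerD (bnd _) _).
apply: (nrm_sum_char_abel (w := fun n => lnn n / n%:R)) => i i4 //.
have ln4 : 1 <= lnn i.
  apply: le_trans (le_lnn R (isT : (0 < 4)%N) i4).
  have := @lnn_step_ge R 1 isT; rewrite mulr1n ln1 subr0.
  have -> : lnn 4 = 2 * lnn 2 by rewrite -(@ln_natX R 2 2).
  lra.
have i0 : 0 < i%:R :> R by rewrite ltr0n; lia.
have := @lnn_step_le R i ltac:(lia); rewrite -(natr1 i) => h.
rewrite ler_pdivrMr; last by lra.
rewrite mulrAC ler_pdivlMr //.
have : i%:R * (ln (i%:R + 1) - lnn i) <= 1.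
  by rewrite mulrC -ler_pdivlMr // mul1r.
lra.
Qed.

(** Expanding [ln] as a divisor sum writes the bounded sum of [chi(n) ln n / n] as the sum of
    [chi(d) Lambda(d) / d] times [charL (N %/ d)]. Replacing [charL (N %/ d)] by [charL N] costs at
    most [Lambda(d) M / N] for each [d], in total [M psi(N) / N <= 4 M]; dividing by [charL N]
    finishes. *)
Lemma charS_bounded (e : R) N0 : 0 < e ->
  (forall N, (N0 <= N)%N -> e <= nrm (charL N)) ->
  exists B : R, forall N, (N0 < N)%N -> nrm (charS N) <= B.
Proof.
move=> e0 good; have [B hB] := nrm_sum_char_ln.
exists ((B + 4 * M%:R) / e) => N NN.
have Npos : (0 < N)%N by lia.
have N0' : 0 < N%:R :> R by rewrite ltr0n.
have eqG : \sum_(1 <= n < N.+1) chi n * (lnn n / n%:R)%:C =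
   \sum_(1 <= d < N.+1) chi d * (Lambda d / d%:R)%:C * charL (N %/ d).
  transitivity (\sum_(1 <= n < N.+1) \sum_(d <- divisors n)
     (chi d * (Lambda d / d%:R)%:C) * (chi (n %/ d)%N * ((n %/ d)%:R^-1)%:C)).
    apply: eq_big_nat => n nN; have n0 : (0 < n)%N by lia.
    rewrite -sum_vonMangoldt // mulr_suml rmorph_sum mulr_sumr /=.
    apply: eq_big_seq => d; rewrite -dvdn_divisors // => dn.
    rewrite -{1 2}(divnK dn) mulnC chiM natrM invfM mulrA !rmorphM /=; ring.
  rewrite (sum_divisors_hyperbola (fun d m => (chi d * (Lambda d / d%:R)%:C) *
    (chi m * (m%:R^-1)%:C))).
  by apply: eq_bigr => d _; rewrite -mulr_sumr.
have diff : nrm (charS N * charL N -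
   \sum_(1 <= n < N.+1) chi n * (lnn n / n%:R)%:C) <= 4 * M%:R.
  rewrite eqG /charS mulr_suml -sumrB; apply: le_trans (nrm_sum _ _ _) _.
  have -> : 4 * M%:R = 4 * N%:R * (M%:R / N%:R) :> R by field; rewrite gt_eqF.
  apply: le_trans (_ : psi R N * (M%:R / N%:R) <= _); last first.
    by rewrite ler_wpM2r ?psi_le // divr_ge0.
  rewrite /psi mulr_suml; apply: ler_sum_nat => d dN.
  have dpos : (0 < d)%N by lia.
  have d0 : 0 < d%:R :> R by rewrite ltr0n.
  rewrite -mulrBr !Normc.normcM nrmR ger0_norm; last first.
    by rewrite divr_ge0 ?vonMangoldt_ge0.
  have -> : Lambda d * (M%:R / N%:R) = 1 * (Lambda d / d%:R) * (M%:R / (N%:R / d%:R)).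
    by field; rewrite !gt_eqF.
  apply: ler_pM; rewrite ?mulr_ge0 ?nrm_ge0 ?invr_ge0 ?vonMangoldt_ge0 //.
    by rewrite ler_wpM2r // divr_ge0 ?vonMangoldt_ge0.
  apply: le_trans (nrm_charLB (leq_div N d)) _.
  rewrite ler_wpM2l // lef_pV2 ?posrE ?divr_gt0 ?ltr0n //.
  by rewrite ler_pdivrMr // -natrM ler_nat ltnW // ltn_ceil.
rewrite ler_pdivlMr //; apply: le_trans (_ : nrm (charS N * charL N) <= _).
  by rewrite Normc.normcM ler_wpM2l ?nrm_ge0 // good // ltnW.
have := le_normcD (charS N * charL N -
   \sum_(1 <= n < N.+1) chi n * (lnn n / n%:R)%:C)
   (\sum_(1 <= n < N.+1) chi n * (lnn n / n%:R)%:C).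
by rewrite subrK => /le_trans; apply; rewrite addrC; apply: lerD.
Qed.

(** The sum of [mu(d) (ln N - ln d)] over the divisors of [n] is [Lambda n], plus [ln N] if [n = 1].
    Since [charL (N %/ d)] is at most [B d / N], the result is at most [B / N] times the sum of
    [ln N - ln d], which is at most [N]. *)
Lemma charS_exceptional (B : R) : 0 <= B ->
  (forall N, nrm (charL N) <= B / N.+1%:R) ->
  forall N, (0 < N)%N -> nrm (charS N + (lnn N)%:C) <= B.
Proof.
clear M_gt0; move=> B0 bad N Npos; have N0' : 0 < N%:R :> R by rewrite ltr0n.
have -> : charS N + (lnn N)%:C =
   \sum_(1 <= d < N.+1) chi d * (mu d * (lnn N - lnn d) / d%:R)%:C * charL (N %/ d).
  transitivity (\sum_(1 <= n < N.+1) \sum_(d <- divisors n)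
     (chi d * (mu d * (lnn N - lnn d) / d%:R)%:C) *
     (chi (n %/ d)%N * ((n %/ d)%:R^-1)%:C)); last first.
    rewrite (sum_divisors_hyperbola (fun d m =>
      (chi d * (mu d * (lnn N - lnn d) / d%:R)%:C) * (chi m * (m%:R^-1)%:C))).
    by apply: eq_bigr => d _; rewrite -mulr_sumr.
  transitivity (\sum_(1 <= n < N.+1)
      chi n * (((n == 1%N)%:R * lnn N + Lambda n) / n%:R)%:C).
    under [RHS]eq_bigr do rewrite mulrDl rmorphD mulrDr /=.
    rewrite big_split /= addrC; congr (_ + _).
    rewrite (bigD1_seq 1%N) ?iota_uniq ?mem_index_iota //=.
    rewrite big1 ?addr0 ?eqxx ?chi1 ?mul1r ?divr1 // => n /negbTE ->.
    by rewrite !mul0r mulr0.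
  apply: eq_big_nat => n nN; have n0 : (0 < n)%N by lia.
  rewrite -sum_mobius // -[Lambda n]opprK -sum_mobius_ln //.
  rewrite mulr_suml -sumrB mulr_suml rmorph_sum mulr_sumr /=.
  apply: eq_big_seq => d; rewrite -dvdn_divisors // => dn.
  rewrite -{1 2}(divnK dn) mulnC chiM natrM invfM -mulrBr !mulrA !rmorphM /=; ring.
apply: le_trans (nrm_sum _ _ _) _.
apply: le_trans (_ : \sum_(1 <= d < N.+1) (lnn N - lnn d) * (B / N%:R) <= _).
  apply: ler_sum_nat => d dN.
  have dpos : (0 < d)%N by lia.
  have d0 : 0 < d%:R :> R by rewrite ltr0n.
  have l0 : 0 <= lnn N - lnn d by rewrite subr_ge0 le_lnn //; lia.
  have -> : (lnn N - lnn d) * (B / N%:R) =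
     1 * ((lnn N - lnn d) / d%:R) * (B / (N%:R / d%:R)).
    by field; rewrite !gt_eqF.
  rewrite !Normc.normcM nrmR; apply: ler_pM; rewrite ?mulr_ge0 ?nrm_ge0 //.
    apply: ler_pM; rewrite ?nrm_ge0 //.
    rewrite !normrM [`|d%:R^-1|]ger0_norm ?invr_ge0 // ler_wpM2r ?invr_ge0 //.
    by rewrite (ger0_norm l0) -[leRHS]mul1r ler_wpM2r // normr_mobius.
  apply: le_trans (bad _) _.
  rewrite ler_wpM2l // lef_pV2 ?posrE ?divr_gt0 ?ltr0n //.
  by rewrite ler_pdivrMr // -natrM ler_nat ltnW // ltn_ceil.
rewrite -mulr_suml sumrB sumr_const_nat subSS subn0 -[_ *+ N]mulr_natl.
rewrite mulrA ler_pdivrMr // mulrC ler_wpM2l //.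
by have := @sum_lnn_ge R N; lra.
Qed.

End CharacterSums.

(** * Geometric sums and Monsky's weight *)

Section Geometric.
Variable R : realFieldType.
Implicit Types (s t x : R) (n : nat).

Lemma bernoulli_ge x n : -1 <= x -> 1 + n%:R * x <= (1 + x) ^+ n.
Proof.
move=> x1; elim: n => [|n IH]; first by rewrite mul0r addr0 expr0.
rewrite exprS -natr1; apply: le_trans (ler_wpM2l _ IH); last by lra.
have : 0 <= n%:R * x ^+ 2 by rewrite mulr_ge0 ?sqr_ge0.
by rewrite expr2; lra.
Qed.

Definition geom t n := \sum_(0 <= i < n) t ^+ i.

Lemma geomS t n : geom t n.+1 = 1 + t * geom t n.
Proof.
rewrite /geom big_nat_recl // expr0 mulr_sumr; congr (_ + _).
by apply: eq_bigr => i _; rewrite exprS.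
Qed.

Lemma geomSr t n : geom t n.+1 = geom t n + t ^+ n.
Proof. by rewrite /geom big_nat_recr. Qed.

Lemma geomE t n : (1 - t) * geom t n = 1 - t ^+ n.
Proof.
elim: n => [|n IH]; first by rewrite /geom big_geq // mulr0 expr0 subrr.
by rewrite geomSr mulrDr IH exprS; ring.
Qed.

Lemma geom_gt0 t n : 0 < t -> (0 < n)%N -> 0 < geom t n.
Proof.
case: n => // n t0 _; rewrite geomS.
suff : 0 <= t * geom t n by lra.
apply: mulr_ge0; rewrite ?(ltW t0) //; apply: sumr_ge0 => i _.
by rewrite exprn_ge0 ?ltW.
Qed.

(* Arithmetic-geometric mean for a geometric progression; its ratio is written
   [s ^ 2] because the geometric mean of [n + 1] terms is [s ^ n]. *)
Lemma geom_agm s n : 0 < s -> n.+1%:R * s ^+ n <= geom (s ^+ 2) n.+1.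
Proof.
move=> s0.
suff: n.+1%:R * s ^+ n <= geom (s ^+ 2) n.+1 /\
      n.+2%:R * s ^+ n.+1 <= geom (s ^+ 2) n.+2 by case.
elim: n => [|n [IH1 IH2]].
  rewrite !geomS /geom big_geq // mulr0 addr0 expr0 expr1 mulr1; split=> //.
  by have := sqr_ge0 (s - 1); rewrite !expr2; lra.
split=> //; rewrite geomS geomSr.
have h1 := ler_wpM2l (sqr_ge0 s) IH1.
have h2 := sqr_ge0 (s ^+ n.+2 - 1).
have e1 : (s ^+ 2) ^+ n.+2 = (s ^+ n.+2) ^+ 2 by rewrite -!exprM mulnC.
have e2 : s ^+ 2 * (n.+1%:R * s ^+ n) = n.+1%:R * s ^+ n.+2.
  by rewrite mulrCA -exprD add2n.
have e3 : s ^+ 2 * (s ^+ 2) ^+ n.+1 = (s ^+ n.+2) ^+ 2 by rewrite -exprS e1.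
rewrite mulrDr e3; rewrite e2 in h1.
have -> : n.+3%:R = n.+1%:R + 2 :> R by rewrite -natrD addn2.
by move: h1 h2; rewrite (expr2 (_ - _)) (expr2 (s ^+ n.+2)); lra.
Qed.

(** The two geometric means multiply to [s ^ (2 n - 1)], which is at least [s ^ (2 n)]. *)
Lemma geom_mul_ge s n : 0 < s -> s <= 1 -> (0 < n)%N ->
  n%:R * n.+1%:R * (s ^+ 2) ^+ n <= geom (s ^+ 2) n * geom (s ^+ 2) n.+1.
Proof.
move=> s0 s1; case: n => // n _.
apply: le_trans (ler_pM _ _ (geom_agm n s0) (geom_agm n.+1 s0)); last 2 first.
- by rewrite mulr_ge0 // exprn_ge0 // ltW.
- by rewrite mulr_ge0 // exprn_ge0 // ltW.
rewrite mulrACA ler_wpM2l // ?mulr_ge0 //.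
rewrite -exprM -exprD.
by apply: ler_wiXn2l; rewrite ?(ltW s0) //; lia.
Qed.

(* [monsky t n] is [1 - t] times [1 / (n (1 - t)) - t ^ n / (1 - t ^ n)], the
   decreasing weight of Monsky's argument. *)
Definition monsky t n : R := n%:R^-1 - t ^+ n / geom t n.

Lemma monsky_ge0 t n : 0 < t -> t <= 1 -> (0 < n)%N -> 0 <= monsky t n.
Proof.
move=> t0 t1 n0; rewrite subr_ge0 ler_pdivrMr ?geom_gt0 // mulrC.
rewrite ler_pdivlMr ?ltr0n // mulr_natr -[n in _ *+ n]subn0 -sumr_const_nat.
by apply: ler_sum_nat => i /andP[_ ni]; apply: ler_wiXn2l; rewrite ?(ltW t0) // ltnW.
Qed.

(** Because [geom t n.+1 - t * geom t n = 1], the decrement is [1 / (n (n + 1)) - t ^ n / (geom t n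
    * geom t n.+1)], and [geom_mul_ge] gives its sign. *)
Lemma monsky_decr s n : 0 < s -> s <= 1 -> (0 < n)%N ->
  monsky (s ^+ 2) n.+1 <= monsky (s ^+ 2) n.
Proof.
move=> s0 s1 n0; set t := s ^+ 2.
have t0 : 0 < t by rewrite exprn_gt0.
have u0 := geom_gt0 t0 n0; have v0 := geom_gt0 t0 (ltn0Sn n).
have n0' : 0 < n%:R :> R by rewrite ltr0n.
rewrite -subr_ge0 /monsky.
have := geom_mul_ge s0 s1 n0; rewrite -/t => h.
have -> : n%:R^-1 - t ^+ n / geom t n - (n.+1%:R^-1 - t ^+ n.+1 / geom t n.+1)
  = (n%:R * n.+1%:R)^-1 - t ^+ n * (geom t n * geom t n.+1)^-1.
  have e : geom t n.+1 - t * geom t n = 1 by rewrite geomS addrK.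
  have -> : t ^+ n * (geom t n * geom t n.+1)^-1 =
      t ^+ n * (geom t n.+1 - t * geom t n) * (geom t n * geom t n.+1)^-1.
    by rewrite e mulr1.
  rewrite exprS -(natr1 n); field.
  by rewrite !gt_eqF //; lra.
rewrite subr_ge0 ler_pdivrMr ?mulr_gt0 // mulrC ler_pdivlMr ?mulr_gt0 ?ltr0n //.
by rewrite mulrC.
Qed.

End Geometric.

(** * Nonvanishing for real characters *)

Section RealNonvanishing.
Variable R : realType.

Variables (M : nat) (c : nat -> R).
Hypothesis M_gt0 : (0 < M)%N.
Hypothesis c1 : c 1%N = 1.
Hypothesis cM : forall m n, c (m * n)%N = c m * c n.
Hypothesis c_sign : forall n, [|| c n == 1, c n == 0 | c n == -1].
Hypothesis c_period : forall n, c (n + M)%N = c n.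
Hypothesis c_sum0 : \sum_(0 <= i < M) c i = 0.

Lemma normr_sign n : `|c n| <= 1.
Proof. by case/or3P: (c_sign n) => /eqP ->; rewrite ?normrN ?normr1 ?normr0. Qed.

Lemma normr_sum_real_char (w : nat -> R) m n :
  (forall i, (m <= i)%N -> 0 <= w i) ->
  (forall i, (m <= i)%N -> w i.+1 <= w i) ->
  `|\sum_(m <= i < n) c i * w i| <= M%:R * w m.
Proof.
move=> w0 wd; rewrite -nrmR rmorph_sum /=.
under eq_bigr do rewrite rmorphM.
apply: (@nrm_sum_char_abel R M (fun n => (c n)%:C)) => //.
- by move=> i; rewrite nrmR normr_sign.
- by move=> i; rewrite c_period.
- by rewrite -rmorph_sum /= c_sum0.
Qed.

Lemma sum_squares_le (G : nat -> R) K N :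
  (forall n, (0 < n)%N -> 0 <= G n) -> (K ^ 2 <= N)%N ->
  \sum_(1 <= m < K.+1) G (m ^ 2)%N <= \sum_(1 <= n < N.+1) G n.
Proof.
move=> G0; have tail a b : (0 < a)%N -> 0 <= \sum_(a <= n < b) G n.
  by move=> a0; rewrite big_nat; apply: sumr_ge0 => n nb; apply: G0; lia.
elim: K N => [|K IH] N KN; first by rewrite big_geq // tail.
have KK : (K ^ 2 < K.+1 ^ 2)%N by rewrite ltn_sqr.
rewrite big_nat_recr //= [leRHS](big_cat_nat (n := (K ^ 2).+1)) //=; last first.
  by rewrite ltnS ltnW // (leq_trans KK KN).
apply: lerD; first exact: IH.
rewrite (big_cat_nat (n := (K.+1 ^ 2)%N)) //=; last exact: leqW.
rewrite [X in _ + X]big_ltn // addrCA lerDl addr_ge0 // tail //; lia.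
Qed.

(** Truncated form of the Lambert identity between the sum of [c(d) t ^ d / (1 - t ^ d)] and the
    power series of the divisor sums. For each [d] the missing multiples start beyond [N], so they
    cost at most [t ^ N] after the factor [1 - t]. *)
Lemma lambert_partial (t : R) N : 0 < t -> t < 1 ->
  (1 - t) * \sum_(1 <= n < N.+1) (\sum_(d <- divisors n) c d) * t ^+ n
  <= \sum_(1 <= d < N.+1) c d * (t ^+ d / geom t d) + N%:R * t ^+ N.
Proof.
move=> t0 t1.
have -> : \sum_(1 <= n < N.+1) (\sum_(d <- divisors n) c d) * t ^+ n =
    \sum_(1 <= d < N.+1) \sum_(1 <= m < (N %/ d).+1) c d * t ^+ (d * m).
  rewrite -(sum_divisors_hyperbola (fun d m => c d * t ^+ (d * m))).
  apply: eq_big_nat => n nN; rewrite mulr_suml; apply: eq_big_seq => d.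
  by rewrite -dvdn_divisors; [move=> dn; rewrite mulnC divnK | lia].
have -> : N%:R * t ^+ N = \sum_(1 <= d < N.+1) t ^+ N.
  by rewrite sumr_const_nat subSS subn0 mulr_natl.
rewrite mulr_sumr -big_split /=; apply: ler_sum_nat => d dN.
have d0 : (0 < d)%N by lia.
set k := (N %/ d)%N; have u0 := geom_gt0 t0 d0.
have geo : (1 - t ^+ d) * \sum_(1 <= m < k.+1) t ^+ (d * m)
    = t ^+ d * (1 - t ^+ (d * k)).
  elim: k => [|k IH]; first by rewrite big_geq // muln0 expr0; ring.
  by rewrite big_nat_recr //= mulrDr IH mulnS exprD; ring.
have -> : (1 - t) * \sum_(1 <= m < k.+1) c d * t ^+ (d * m)
   = c d * (t ^+ d / geom t d) - c d * (t ^+ (d * k.+1) / geom t d).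
  have e : (1 - t) * \sum_(1 <= m < k.+1) t ^+ (d * m)
      = (t ^+ d - t ^+ (d * k.+1)) / geom t d.
    apply: (mulIf (lt0r_neq0 u0)); rewrite divfK ?gt_eqF // mulrAC geomE geo.
    by rewrite mulnS exprD; ring.
  by rewrite -mulr_sumr mulrCA e; ring.
rewrite lerD2l -mulrN; set y := _ / _.
have y0 : 0 <= y by rewrite divr_ge0 ?exprn_ge0 ?(ltW t0) ?(ltW u0).
have yN : y <= t ^+ N.
  have g1 : 1 <= geom t d.
    case: (d) d0 => // d' _; rewrite geomS lerDl mulr_ge0 ?(ltW t0) // sumr_ge0 //.
    by move=> i _; rewrite exprn_ge0 ?(ltW t0).
  rewrite ler_pdivrMr //; apply: le_trans (_ : t ^+ N * 1 <= _); last first.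
    by rewrite ler_wpM2l // exprn_ge0 // ltW.
  rewrite mulr1; apply: ler_wiXn2l; rewrite ?(ltW t0) ?(ltW t1) //.
  by rewrite mulnC ltnW // ltn_ceil.
apply: le_trans yN; rewrite mulrN -mulNr -[leRHS]mul1r ler_wpM2r //.
by apply: le_trans (ler_norm _) _; rewrite normrN normr_sign.
Qed.

(** For [t] near 1 the squares make the power series of the divisor sums at least [K / 2 = M + 2].
    Yet [1 - t] times it is, up to terms vanishing as [N] grows, minus the sum of [c(n)] against
    [monsky t], and summation by parts bounds that by [M (1 - t)]. *)
Lemma real_char_not_exceptional (B : R) :
  ~ (forall N, `|\sum_(1 <= n < N.+1) c n / n%:R| <= B / N.+1%:R).
Proof.
(* With this [d], Bernoulli's inequality gives [t ^ (m ^ 2) >= 1 - 2 m ^ 2 d >= 1 / 2] for every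
   [m <= K]. *)
move=> bad; pose K := (2 * M + 4)%N; pose d : R := (4 * K ^ 2)%:R^-1.
have K0 : (0 < K)%N by rewrite /K; lia.
have d0 : 0 < d by rewrite invr_gt0 ltr0n; nia.
have d1 : d <= 4^-1 by rewrite lef_pV2 ?posrE ?ltr0n ?ler_nat //; nia.
pose s := 1 - d; pose t := s ^+ 2.
have s0 : 0 < s by rewrite /s; lra.
have s1 : s < 1 by rewrite /s; lra.
have t0 : 0 < t by rewrite exprn_gt0.
have t1 : t < 1 by rewrite exprn_ilt1 // ltW.
have B0 : 0 <= B by have := bad 0%N; rewrite divr1; apply: le_trans.
have lower N : (K ^ 2 <= N)%N ->
    K%:R / 2 <= \sum_(1 <= n < N.+1) (\sum_(d <- divisors n) c d) * t ^+ n.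
  move=> KN; have G0 n : (0 < n)%N -> 0 <= (\sum_(d <- divisors n) c d) * t ^+ n.
    by move=> n0; rewrite mulr_ge0 ?sum_char_ge0 // exprn_ge0 // ltW.
  apply: le_trans (sum_squares_le G0 KN).
  have -> : K%:R / 2 = \sum_(1 <= m < K.+1) 2^-1 :> R.
    by rewrite sumr_const_nat subSS subn0 mulr_natl.
  apply: ler_sum_nat => m mK.
  rewrite -[leLHS]mul1r; apply: ler_pM; rewrite ?ler01 ?invr_ge0 //.
    by rewrite sum_char_square //; lia.
  rewrite /t -exprM /s; apply: le_trans (bernoulli_ge _ _); last by lra.
  have : (2 * m ^ 2)%:R * d <= 2^-1.
    rewrite /d ler_pdivrMr ?ltr0n; last by nia.
    rewrite mulrC ler_pdivlMr // -natrM ler_nat; nia.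
  lra.
have upper N : 2 * d <= B / N.+1%:R + N%:R * t ^+ N \/ (N < K ^ 2)%N.
  have [|KN] := ltnP N (K ^ 2); [by right|left].
  have low := lower N KN; have lam := lambert_partial N t0 t1.
  have ab := @normr_sum_real_char (monsky t) 1 N.+1
    (fun i i1 => monsky_ge0 t0 (ltW t1) i1)
    (fun i i1 => monsky_decr s0 (ltW s1) i1).
  have split_sum : \sum_(1 <= e < N.+1) c e * (t ^+ e / geom t e) =
     \sum_(1 <= e < N.+1) c e / e%:R - \sum_(1 <= e < N.+1) c e * monsky t e.
    by rewrite -sumrB; apply: eq_bigr => e _; rewrite /monsky; ring.
  have m1 : monsky t 1 = 1 - t.
    by rewrite /monsky /geom big_nat1 expr0 expr1 invr1 mulr1.
  have bN := bad N; rewrite split_sum in lam; rewrite m1 in ab.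
  have h1 : d <= 1 - t by rewrite /t /s expr2; nra.
  have h2 := ler_wpM2l (ltW (lt_le_trans d0 h1)) low.
  have h3 : (M%:R + 2) = K%:R / 2 :> R by rewrite /K natrD natrM; field.
  rewrite -h3 in h2.
  have a1 := ler_norm (\sum_(1 <= n < N.+1) c n / n%:R).
  have a2 := ler_norm (- (\sum_(1 <= e < N.+1) c e * monsky t e)).
  rewrite normrN in a2; move: (le_trans h2 lam); rewrite mulrDr.
  move: bN ab a1 a2 h1; rewrite [M%:R * _]mulrC.
  move: (\sum_(1 <= n < N.+1) c n / n%:R) (\sum_(1 <= n < N.+1) c n * monsky t n).
  by move: (B / _) (N%:R * _) (1 - t) => x y z x' y'; lra.
(* This makes the two error terms, at most [B / N] and [1 / (d ^ 2 N)], add up to less than [d]. *)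
pose N := maxn (K ^ 2) (Num.bound ((B + (d ^+ 2)^-1) / d)).
have N0 : (0 < N)%N by rewrite /N; nia.
have N0' : 0 < N%:R :> R by rewrite ltr0n.
case: (upper N) => [h|]; last by rewrite /N; lia.
have big : (B + (d ^+ 2)^-1) / d < N%:R.
  apply: lt_le_trans (archi_boundP _) _; last by rewrite ler_nat leq_maxr.
  by rewrite divr_ge0 ?addr_ge0 ?invr_ge0 ?exprn_ge0 // ltW.
(* By Bernoulli [s ^ N * N * d <= ((1 - d) (1 + d)) ^ N <= 1]; squaring gives the bound. *)
have tN : N%:R * t ^+ N <= (d ^+ 2)^-1 / N%:R.
  have h1 : s ^+ N * (N%:R * d) <= 1.
    apply: le_trans (_ : s ^+ N * (1 + d) ^+ N <= _).
      rewrite ler_wpM2l ?exprn_ge0 // ?(ltW s0) //.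
      by apply: le_trans (bernoulli_ge _ _); lra.
    rewrite -exprMn exprn_ile1 //; rewrite /s; nra.
  have h2 : 0 <= s ^+ N * (N%:R * d) by rewrite !mulr_ge0 ?exprn_ge0 // ltW.
  rewrite ler_pdivlMr // -[leRHS]mul1r ler_pdivlMr ?exprn_gt0 //.
  have -> : N%:R * t ^+ N * N%:R * d ^+ 2 = (s ^+ N * (N%:R * d)) ^+ 2.
    by rewrite /t -exprM mulnC exprM; ring.
  by rewrite exprn_ile1.
have : B / N.+1%:R <= B / N%:R.
  by rewrite ler_wpM2l // lef_pV2 ?posrE ?ltr0n // ler_nat.
rewrite ltr_pdivrMr // in big.
have : (B + (d ^+ 2)^-1) / N%:R < d by rewrite ltr_pdivrMr // mulrC.
rewrite mulrDl; move: h tN d0; clearbody d N t.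
by move: (B / _) (N%:R * _) (B / _) (_ / N%:R) => x y z x'; lra.
Qed.

End RealNonvanishing.

(** * Primes in arithmetic progressions *)

Section PrimesInProgressions.
Variable R : realType.
Local Notation C := R[i].
Local Notation nrm := (@Normc.normc R).
Local Notation lnn n := (ln (n%:R : R)).
Local Notation Lambda := (@vonMangoldt R).

Lemma lnn_unbounded (K : R) (N0 : nat) : exists2 N, (N0 < N)%N & K < lnn N.
Proof.
pose k := maxn N0 (Num.bound (2 * `|K|)); exists (2 ^ k)%N.
  by apply: leq_ltn_trans (ltn_expl k _) => //; rewrite leq_maxl.
rewrite ln_natX //; apply: le_lt_trans (ler_norm K) _.
have l2 : 2^-1 <= ln 2 :> R.
  by have := @lnn_step_ge R 1 isT; rewrite mulr1n ln1 subr0.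
have hk : 2 * `|K| < k%:R.
  apply: lt_le_trans (archi_boundP _) _; first by rewrite mulr_ge0.
  by rewrite ler_nat leq_maxr.
have k0 : 0 <= k%:R :> R by [].
have := ler_wpM2l k0 l2; lra.
Qed.

Lemma vonMangoldt_div_ge0 n : 0 <= Lambda n / n%:R.
Proof. by rewrite divr_ge0 ?vonMangoldt_ge0. Qed.

(* Proper prime powers contribute a bounded amount, so the sum over [P] is
   bounded as soon as [P] contains only finitely many primes. *)
Lemma sum_vonMangoldt_few_primes (P : pred nat) (B N : nat) :
  (forall p, prime p -> P p -> (p <= B)%N) ->
  \sum_(1 <= n < N.+1 | P n) Lambda n / n%:R
  <= 2 + \sum_(1 <= n < B.+1) Lambda n / n%:R.
Proof.
move=> few; apply: le_trans (_ : \sum_(1 <= n < N.+1 | ~~ prime n) Lambda n / n%:R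
  + \sum_(1 <= n < N.+1 | (n <= B)%N) Lambda n / n%:R <= _).
  rewrite [leLHS]big_mkcond [X in X + _]big_mkcond [X in _ + X]big_mkcond.
  rewrite -big_split /=; apply: ler_sum => n _.
  have L0 := vonMangoldt_div_ge0 n; case Pn: (P n); last first.
    by rewrite addr_ge0 //; case: ifP.
  case: (boolP (prime n)) => [pn|_] /=; first by rewrite few // add0r.
  by rewrite lerDl; case: ifP.
apply: lerD; first exact: sum_vonMangoldt_nonprime.
have [NB|BN] := leqP N B.
  rewrite [leRHS](big_cat_nat (n := N.+1)) //= big_mkcond.
  rewrite -[leLHS]addr0; apply: lerD.
    by apply: ler_sum => n _; have := vonMangoldt_div_ge0 n; case: ifP.
  by apply: sumr_ge0 => n _; apply: vonMangoldt_div_ge0.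
rewrite (big_cat_nat (n := B.+1)) //=; last by lia.
rewrite [X in _ + X]big1_seq ?addr0 => [|n /andP[nB]]; last first.
  by rewrite mem_index_iota; lia.
by rewrite big_mkcond; apply: ler_sum => n _; have := vonMangoldt_div_ge0 n; case: ifP.
Qed.

Lemma exists_uniform_bound (I : finType) (f : I -> nat -> R) :
  (forall i, exists B N0, forall N, (N0 < N)%N -> f i N <= B) ->
  exists B N0, forall N, (N0 < N)%N -> \sum_i f i N <= B.
Proof.
move=> h; have [B hB] := boolp.choice h; have [N0 hN] := boolp.choice hB.
exists (\sum_i B i), (\max_i N0 i)%N => N NN; apply: ler_sum => i _.
by apply: hN; apply: leq_ltn_trans NN; apply: leq_bigmax.
Qed.

Section Progression.
Variables (M : nat) (I : finType) (chi : I -> nat -> C) (i0 : I).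
Hypothesis M_gt1 : (1 < M)%N.
Hypothesis chi_char : forall i, [/\ chi i 1%N = 1,
  forall m n, chi i (m * n)%N = chi i m * chi i n,
  forall n, nrm (chi i n) = (coprime M n)%:R &
  forall n, chi i (n + M)%N = chi i n].
Hypothesis chi_principal : forall n, chi i0 n = (coprime M n)%:R.
Hypothesis chi_sum0 : forall i, i != i0 -> \sum_(0 <= n < M) chi i n = 0.
Hypothesis chi_conj : forall i,
  exists2 j, forall n, chi j n = (chi i n)^*%C &
             (i = j \/ exists n, chi j n != chi i n).
Hypothesis chi_orth : forall a n, coprime M a ->
  \sum_i (chi i a)^*%C * chi i n = if n == a %[mod M] then #|I|%:R else 0.

(** The decay condition expresses [L(1, chi i) = 0] through partial sums. *)
Definition exceptional i := (i != i0) &&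
  `[< exists2 B : R, 0 <= B & forall N, nrm (charL (chi i) N) <= B / N.+1%:R >].

(** The coefficient of [ln N] in [charS (chi i) N]; classically the residue of [- L' / L] at 1. *)
Definition residue i : R :=
  if i == i0 then 1 else if exceptional i then -1 else 0.

Lemma charS_asymptotic i : exists B N0 : _, forall N, (N0 < N)%N ->
  nrm (charS (chi i) N - (residue i * lnn N)%:C) <= B :> R.
Proof.
have [c1 cM cn cp] := chi_char i; rewrite /residue.
have cle n : nrm (chi i n) <= 1 by rewrite cn lern1 leq_b1.
have [->|ii0] := eqVneq i i0; last first.
  have M0 : (0 < M)%N by lia.
  have s0 := chi_sum0 ii0; rewrite /exceptional ii0 /=.
  case: asboolP => [[B B0 exc]|good].
    exists B, 0%N => N N0; rewrite mulN1r rmorphN opprK.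
    exact: (charS_exceptional c1 cM cle).
  have [//|[e e0 [N0 hN]]] := charL_dichotomy M0 cle cp s0.
  have [B hB] := charS_bounded M0 cM cle cp s0 e0 hN.
  by exists B, N0 => N NN; rewrite mul0r subr0 hB.
(* The principal character differs from Mertens' sum only by powers of primes dividing [M], whose
   contribution is at most [D]. *)
pose D := 2 + \sum_(1 <= n < M.+1) Lambda n / n%:R.
exists (4 + D), 0%N => N N0; rewrite mul1r.
have -> : charS (chi i0) N = (\sum_(1 <= n < N.+1 | coprime M n) Lambda n / n%:R)%:C.
  rewrite /charS rmorph_sum [RHS]big_mkcond /=; apply: eq_bigr => n _.
  by rewrite chi_principal; case: ifP; rewrite ?mul1r ?mul0r.
rewrite -rmorphB nrmR.
have noncop : \sum_(1 <= n < N.+1 | ~~ coprime M n) Lambda n / n%:R <= D.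
  apply: sum_vonMangoldt_few_primes => p pp; rewrite coprime_sym prime_coprime //.
  by rewrite negbK => /dvdn_leq; apply; lia.
have nonneg : 0 <= \sum_(1 <= n < N.+1 | ~~ coprime M n) Lambda n / n%:R.
  by apply: sumr_ge0 => n _; apply: vonMangoldt_div_ge0.
have := sum_vonMangoldt_div R N0; rewrite (bigID (coprime M)) /=.
move: (\sum_(_ <= _ < _ | ~~ _) _) noncop nonneg => x xD x0.
move: (\sum_(_ <= _ < _ | _) _) => y; rewrite !ler_norml.
by move=> /andP[h1 h2]; apply/andP; split; lra.
Qed.

Definition progS a N : R :=
  \sum_(1 <= n < N.+1 | n == a %[mod M]) Lambda n / n%:R.

Lemma progS_char a N : coprime M a ->
  (#|I|%:R * progS a N)%:C = \sum_i (chi i a)^*%C * charS (chi i) N.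
Proof.
move=> ca; under eq_bigr do rewrite /charS mulr_sumr.
rewrite exchange_big /= rmorphM /progS rmorph_sum mulr_sumr big_mkcond /=.
apply: eq_bigr => n _; under eq_bigr do rewrite mulrA.
rewrite -mulr_suml chi_orth //; case: ifP => _; last by rewrite mul0r.
by rewrite rmorph_nat.
Qed.

Lemma progS_asymptotic a : coprime M a -> exists B N0 : _, forall N, (N0 < N)%N ->
  nrm ((#|I|%:R * progS a N)%:C
       - \sum_i (chi i a)^*%C * (residue i * lnn N)%:C) <= B :> R.
Proof.
move=> ca; have [B [N0 h]] := exists_uniform_bound charS_asymptotic.
exists B, N0 => N NN; apply: le_trans (h N NN).
rewrite progS_char // -sumrB; apply: le_trans (nrm_sum _ _ _) _.
apply: ler_sum => i _; rewrite -mulrBr Normc.normcM nrm_conj.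
have [_ _ -> _] := chi_char i.
by rewrite -[leRHS]mul1r ler_wpM2r ?nrm_ge0 // lern1 leq_b1.
Qed.

(** The residues add up to 1 minus this cardinal. Were that negative, the nonnegative [progS 1 N]
    would tend to minus infinity. *)
Lemma card_exceptional : (#|[pred i | exceptional i]| <= 1)%N.
Proof.
have [B [N0 h]] := progS_asymptotic (coprimen1 M).
rewrite leqNgt; apply/negP => two.
have [N NN big] := lnn_unbounded B N0; have := h N NN.
have -> : \sum_i (chi i 1%N)^*%C * (residue i * lnn N)%:C =
   ((1 - #|[pred i | exceptional i]|%:R) * lnn N)%:C.
  transitivity (\sum_i (residue i * lnn N)%:C).
    apply: eq_bigr => i _; have [-> _ _ _] := chi_char i.
    by rewrite conjc1 mul1r.
  rewrite -rmorph_sum -mulr_suml (bigD1 i0) //= {1}/residue eqxx.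
  congr (_%:C); congr ((1 + _) * _).
  rewrite -sumr_const -sumrN big_mkcond [RHS]big_mkcond; apply: eq_bigr => i _.
  rewrite inE /residue; have [->|ii0] := eqVneq i i0; last by [].
  by rewrite /exceptional eqxx.
rewrite -rmorphB nrmR => /(le_trans (ler_norm _)).
have p0 : 0 <= #|I|%:R * progS 1 N.
  by rewrite mulr_ge0 // sumr_ge0 // => n _; apply: vonMangoldt_div_ge0.
have l0 := lnn_ge0 R N.
have two' : 2 <= #|[pred i | exceptional i]|%:R :> R by rewrite ler_nat.
have := ler_wpM2r l0 two'; move: (#|_|%:R * progS 1 N) p0 => x x0.
by move: #|_|%:R two' => y _; lra.
Qed.

(** The conjugate of an exceptional character is exceptional, so uniqueness makes the character
    real, and [real_char_not_exceptional] applies. *)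
Lemma not_exceptional i : ~~ exceptional i.
Proof.
apply/negP => exi; have [j ej dj] := chi_conj i.
have [ci1 ciM cin cip] := chi_char i.
have LL N : charL (chi j) N = (charL (chi i) N)^*%C.
  rewrite /charL rmorph_sum; apply: eq_bigr => n _.
  by rewrite rmorphM ej /= oppr0.
have exj : exceptional j.
  have := exi; rewrite /exceptional => /andP[ii0 /asboolP[B B0 hB]].
  apply/andP; split.
    (* Were the conjugate principal, [chi i] would be the indicator of coprimality, whose sum over a
       period is positive. *)
    apply/eqP => ji0; have := chi_sum0 ii0.
    rewrite (eq_bigr (fun n => (coprime M n)%:R)) => [|n _]; last first.
      by rewrite -[LHS]conjcK -ej ji0 chi_principal conjc_nat.
    rewrite -natr_sum => /eqP; rewrite pnatr_eq0 (bigD1_seq 1%N) ?iota_uniq //=.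
      by rewrite coprimen1.
    by rewrite mem_index_iota.
  by apply/asboolP; exists B => // N; rewrite LL nrm_conj.
have ij : i = j.
  case: dj => // -[n ne]; have := card_exceptional.
  rewrite leqNgt => /negP[]; apply/card_gt1P; exists i, j; split=> //.
  by apply: contraNneq ne => <-.
have real n : chi i n = (complex.Re (chi i n))%:C.
  have := ej n; rewrite -ij; case: (chi i n) => x y /= [e].
  by apply/eqP; rewrite eq_complex /= eqxx /=; apply/eqP; lra.
move: exi => /andP[ii0 /asboolP[B _ hB]].
have sign n : [|| complex.Re (chi i n) == 1, complex.Re (chi i n) == 0
    | complex.Re (chi i n) == -1].
  have := cin n; rewrite real nrmR; case: (coprime M n) => /= /eqP.
    by rewrite eqr_norml ler01 andbT => /orP[] ->; rewrite ?orbT.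
  by rewrite normr_eq0 => ->; rewrite orbT.
have M0 : (0 < M)%N by lia.
have LR N : charL (chi i) N = (\sum_(1 <= n < N.+1) complex.Re (chi i n) / n%:R)%:C.
  rewrite /charL rmorph_sum; apply: eq_bigr => n _.
  by rewrite rmorphM /= -real.
apply: (@real_char_not_exceptional R M
  (fun n => complex.Re (chi i n)) M0 _ _ sign _ _ B).
- by rewrite ci1.
- move=> m n; have := ciM m n; rewrite (real m) (real n) -rmorphM => ->.
  by [].
- by move=> n; rewrite cip.
- have := chi_sum0 ii0; under eq_bigr do rewrite real.
  by rewrite -rmorph_sum => -[].
- by move=> N; have := hB N; rewrite LR nrmR.
Qed.

Lemma progression_unbounded a : coprime M a -> exists B N0 : _,
  forall N, (N0 < N)%N -> lnn N <= #|I|%:R * progS a N + B :> R.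
Proof.
move=> ca; have [B [N0 h]] := progS_asymptotic ca.
exists B, N0 => N NN; have := h N NN.
have -> : \sum_i (chi i a)^*%C * (residue i * lnn N)%:C = (lnn N)%:C.
  rewrite (bigD1 i0) //= big1 => [|i ii0]; last first.
    by rewrite /residue (negbTE ii0) (negbTE (not_exceptional i)) mul0r mulr0.
  by rewrite addr0 /residue eqxx mul1r chi_principal ca conjc1 mul1r.
rewrite -rmorphB nrmR => /ler_normlP[+ _].
by move: (_ * _) => x; lra.
Qed.

End Progression.

(** If no prime of the class exceeded [B], then [progS] would be bounded, while it dominates a
    positive multiple of [ln N] up to a constant. *)
Theorem primes_in_progression (M a B : nat) : (1 < M)%N -> coprime M a ->
  exists p, [/\ prime p, p = a %[mod M] & (B < p)%N].
Proof.
move=> M1 ca.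
have [I [chi [i0 [h1 h2 h3 h4 h5]]]] := dirichlet_characters R M1.
have [K [N0 hN]] := progression_unbounded M1 h1 h2 h3 h4 h5 ca.
apply: contrapT => no.
pose D := 2 + \sum_(1 <= n < B.+1) Lambda n / n%:R.
have [N NN] := lnn_unbounded (#|I|%:R * D + K) N0.
rewrite ltNge => /negP; apply; apply: le_trans (hN N NN) _.
rewrite lerD2r ler_wpM2l // /progS; apply: sum_vonMangoldt_few_primes => p pp /eqP e.
by rewrite leqNgt; apply/negP => pB; apply: no; exists p.
Qed.

End PrimesInProgressions.

End DirichletTheorem.

(** * Walks of length five *)

Local Open Scope nat_scope.

Lemma coprime_modn_eq (d m n : nat) : m = n %[mod d] -> coprime d m = coprime d n.
Proof. by move=> e; rewrite -coprime_modr e coprime_modr. Qed.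

(** For a prime [l] dividing [m], take [u = 1] modulo [l] unless [l] divides [a + 1], and [u = -1]
    in that case, where [a u + 1 = 2] is invertible because [l] is odd. The factors [m1] and [m2] of
    [m] collect the primes of the two kinds. *)
Lemma exists_unit_shift (a m : nat) : odd m ->
  exists2 u, coprime m u & forall p, p = u %[mod m] -> coprime m (a * p + 1).
Proof.
move=> om; have m0 : 0 < m by case: m om.
set pi := \pi(a.+1); pose m1 := m`_pi^'; pose m2 := m`_pi.
have m12 : m2 * m1 = m by rewrite partnC.
have cop12 : coprime m1 m2 by rewrite coprime_sym coprime_partC.
have u1 := chinese_modl cop12 1 m2.-1; have u2 := chinese_modr cop12 1 m2.-1.
set u := chinese _ _ _ _ in u1 u2.
have m2_gt0 : 0 < m2 by rewrite part_gt0.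
exists u.
  rewrite -m12 coprimeMl (coprime_modn_eq u2) (coprime_modn_eq u1) coprimen1.
  by rewrite andbT -{1}(prednK m2_gt0) coprimeSn.
move=> p pu.
have p1 : p = 1 %[mod m1].
  by rewrite -u1 -(modn_dvdm p (_ : m1 %| m)) ?pu ?modn_dvdm // -m12 dvdn_mull.
have p2 : p = m2.-1 %[mod m2].
  by rewrite -u2 -(modn_dvdm p (_ : m2 %| m)) ?pu ?modn_dvdm // -m12 dvdn_mulr.
rewrite coprime_has_primes ?addn1 //; apply/hasPn => l.
rewrite !mem_primes => /and3P[pl _ la]; rewrite pl m0 /=; apply/negP => lm.
have [lpi|lpi] := boolP (l \in pi).
  have lm2 : l %| m2.
    have : l %| m2 * m1 by rewrite m12.
    rewrite Euclid_dvdM // => /orP[//|lm1].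
    have := pnatPpi (part_pnat pi^' m) (_ : l \in \pi(m1)).
    rewrite mem_primes pl part_gt0 lm1 => /(_ isT).
    by rewrite inE /= lpi.
  have lp : l %| p.+1.
    apply: dvdn_trans lm2 _; rewrite /dvdn -addn1 -modnDml p2 modnDml addn1.
    by rewrite prednK // modnn.
  have la1 : l %| a.+1 by move: lpi; rewrite mem_primes => /and3P[].
  have l2 : l %| 2.
    rewrite -(dvdn_addr 2 (dvdn_mull a lp)).
    have -> : a * p.+1 + 2 = (a * p).+1 + a.+1 by rewrite mulnS; lia.
    exact: dvdn_add.
  by move: l2 lm; rewrite dvdn_prime2 // => /eqP ->; rewrite dvdn2 om.
have lm1 : l %| m1.
  have : l %| m2 * m1 by rewrite m12.
  rewrite Euclid_dvdM // => /orP[lm2|//].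
  have := pnatPpi (part_pnat pi m) (_ : l \in \pi(m2)).
  by rewrite mem_primes pl part_gt0 lm2 => /(_ isT); rewrite (negbTE lpi).
have pl1 : p = 1 %[mod l].
  by rewrite -(modn_dvdm p lm1) p1 modn_dvdm.
move: lpi; rewrite mem_primes pl /= => /negP; apply.
by move: la; rewrite /dvdn -addn1 -modnDml -modnMmr pl1 modnMmr muln1 modnDml addn1.
Qed.

Lemma gcdn_four_dvd (A M : nat) : 0 < M -> 4 %| M -> A = 2 %[mod 4] ->
  coprime A (M`_2^') -> gcdn A M = 2.
Proof.
move=> M0 M4 A2 copA.
have eA : A = 2 * (A %/ 2) by lia.
have eM : M = 2 * (M %/ 2) by lia.
have oA : odd (A %/ 2) by lia.
have cop : coprime (A %/ 2) (M`_2^').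
  by apply: coprime_dvdl copA; rewrite [X in _ %| X]eA dvdn_mull.
rewrite eA eM -muln_gcdr (_ : gcdn _ _ = 1) //; apply/eqP.
have dv : M %/ 2 %| M by rewrite [X in _ %| X]eM dvdn_mull.
suff: coprime (A %/ 2) M by apply: coprime_dvdr.
rewrite -(partnC 2 M0) coprimeMr cop andbT p_part.
by rewrite coprimeXr // coprimen2.
Qed.

(** The conclusion no longer mentions real numbers, so one concrete [realType] is enough. *)
Lemma dirichlet_primes (m a B : nat) : 1 < m -> coprime m a ->
  exists p, [/\ prime p, p = a %[mod m] & B < p].
Proof. exact: (@primes_in_progression (Rdefinitions.R : realType)). Qed.

(** * Choice of the primes along the walk *)

Section PrimeSteps.
Variable M : nat.
Hypothesis M_gt0 : 0 < M.
Hypothesis M_four : 4 %| M.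

(* The prime 2 is the only obstruction to making [a * p + 1] a unit modulo [M]. *)
Lemma exists_prime_gcd (a : nat) : exists p, [/\ prime p, coprime M p &
  gcdn (a * p + 1) M = if odd a then 2 else 1].
Proof.
pose m := M`_2^'; have om : odd m by rewrite odd_2'nat part_pnat.
have m0 : 0 < m := part_gt0 _ _.
have [u cu hu] := exists_unit_shift a om.
(* For odd [a], [p = a] modulo 4 gives [a * p + 1 = a ^ 2 + 1 = 2] modulo 4, a single factor 2; for
   even [a] any odd [p] makes [a * p + 1] odd. *)
pose v := if odd a then a else 1; have ov : odd v by rewrite /v; case: ifP.
have c4 : coprime 4 m by rewrite (@coprimeXl 2 2) // coprime2n.
have e4 := chinese_modl c4 v u; have em := chinese_modr c4 v u.
set c := chinese _ _ _ _ in e4 em.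
have cop : coprime (4 * m) c.
  rewrite coprimeMl (coprime_modn_eq e4) (coprime_modn_eq em) cu andbT.
  by rewrite (@coprimeXl 2 2) // coprime2n.
(* Asking for [p > M] makes [p] coprime to [M]. *)
have [|p [pp pc pM]] := @dirichlet_primes (4 * m) c M _ cop; first by lia.
have p4 : p = v %[mod 4].
  by rewrite -e4 -(modn_dvdm p (dvdn_mulr m (dvdnn 4))) pc modn_dvdm ?dvdn_mulr.
have pm : p = u %[mod m].
  by rewrite -em -(modn_dvdm p (dvdn_mull 4 (dvdnn m))) pc modn_dvdm ?dvdn_mull.
have cpM : coprime M p.
  rewrite coprime_sym prime_coprime //; apply/negP => /(dvdn_leq M_gt0); lia.
exists p; split=> //; have cA := hu p pm; rewrite coprime_sym in cA.
have [oa|ea] := ifPn.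
  have p4a : p = a %[mod 4] by rewrite p4 /v oa.
  have A2 : a * p + 1 = 2 %[mod 4].
    rewrite -modnDml -modnMmr p4a modnMmr modnDml.
    have /orP[/eqP e|/eqP e] : (a %% 4 == 1) || (a %% 4 == 3).
      have : odd (a %% 4) by rewrite odd_mod.
      by case: (a %% 4) (ltn_pmod a (isT : 0 < 4)) => [|[|[|[|]]]].
      by rewrite -modnDml -modnMm e.
    by rewrite -modnDml -modnMm e.
  exact: gcdn_four_dvd.
apply/eqP; rewrite -/(coprime _ M) -(partnC 2 M_gt0) coprimeMr cA andbT p_part.
by rewrite coprimeXr // coprimen2 oddD oddM (negbTE ea).
Qed.

Lemma exists_prime_steps (a n B : nat) : odd a = odd n ->
  exists p q r, [/\ prime p, prime q, prime r, B < r &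
    ((a * p + 1) * q - 1) * r = n %[mod M]].
Proof.
move=> par; have [p [pp cp gA]] := exists_prime_gcd a.
have [s [ps cs gD]] := exists_prime_gcd n.
set A := a * p + 1 in gA *; set D := n * s + 1 in gD; rewrite -par in gD.
set g := (if _ then _ else _) in gA gD.
have g2 : g <= 2 by rewrite /g; case: ifP.
have g0 : 0 < g by rewrite /g; case: ifP.
have gA' : g %| A by rewrite -gA dvdn_gcdl.
have gD' : g %| D by rewrite -gD dvdn_gcdl.
have gM : g %| M by rewrite -gA dvdn_gcdr.
have M4 : 4 <= M by apply: dvdn_leq.
have cop_quot X : g %| X -> gcdn X M = g -> coprime (X %/ g) (M %/ g).
  move=> gX e; rewrite /coprime -(eqn_pmul2l g0) muln_gcdr muln1.
  by rewrite !(mulnC g) !divnK // e.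
have inv (X m : nat) : 0 < X -> coprime X m ->
    exists y, coprime m y /\ X * y = 1 %[mod m].
  move=> X0 /(coprimeP _ X0)[[y z] /= e].
  have h : X * y = 1 %[mod m].
    have -> : X * y = 1 + z * m by rewrite mulnC; lia.
    by rewrite addnC modnMDl.
  exists y; split=> //.
  by have := coprimen1 m; rewrite -(coprime_modn_eq h) coprimeMr => /andP[].
have Mg1 : 1 < M %/ g by rewrite ltn_divRL //; lia.
have [|x [cx hx]] := inv _ _ _ (cop_quot A gA' gA).
  by rewrite divn_gt0 // dvdn_leq // /A addn1.
(* After division by [g], the congruence [A * q = D] has unit coefficients modulo [M %/ g], so the
   residue it prescribes for [q] is one that Dirichlet's theorem reaches. *)
have ct : coprime (M %/ g) (x * (D %/ g)).
  by rewrite coprimeMr cx coprime_sym cop_quot.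
have [q [pq qt _]] := dirichlet_primes 0 Mg1 ct.
have [|y [cy hy]] := inv s M (prime_gt0 ps); first by rewrite coprime_sym.
have [r [pr ry rB]] := @dirichlet_primes M y B ltac:(lia) cy.
exists p, q, r; split=> //.
have AD : A * q = D %[mod M].
  rewrite -(divnK gA') -(divnK gD') -(divnK gM) ![_ * g]mulnC -mulnA.
  rewrite -!muln_modr; congr (_ * _).
  by rewrite -modnMmr qt modnMmr mulnA -modnMml hx modnMml mul1n.
(* Positivity keeps the truncated subtraction of 1 exact. *)
have Aq0 : 0 < A * q by rewrite muln_gt0 (prime_gt0 pq) andbT /A addn1.
have N1 : A * q - 1 = n * s %[mod M].
  by apply/eqP; rewrite -(eqn_modDr 1) subnK // AD.
have sr : s * r = 1 %[mod M] by rewrite -modnMmr ry modnMmr.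
by rewrite -modnMml N1 modnMml -mulnA -modnMmr sr modnMmr muln1.
Qed.
End PrimeSteps.

(** * Distances in the graph *)

Local Open Scope classical_set_scope.

Lemma adj_succ (x y : vertex) : val y = (val x).+1 -> adj x y.
Proof.
by move=> e; rewrite /adj e (minn_idPl (leqnSn _)) (maxn_idPr (leqnSn _)) subSnn.
Qed.

Lemma adj_mul_prime (x y : vertex) (p : nat) :
  prime p -> val y = val x * p -> adj x y.
Proof.
move=> pp e; have le : val x <= val x * p by rewrite leq_pmulr ?prime_gt0.
rewrite /adj e (minn_idPl le) (maxn_idPr le) dvdn_mulr //= mulKn ?(valP x) //.
by rewrite pp orbT.
Qed.

Lemma dist_le_walk (x y : vertex) (k : nat) : walk x y k -> dist x y <= k.
Proof. by move=> w; rewrite /dist; case: ex_minnP => m _; apply; apply/asboolP. Qed.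

Lemma walk_dist (x y : vertex) : walk x y (dist x y).
Proof. by rewrite /dist; case: ex_minnP => m /asboolP. Qed.

Lemma dist_prime_steps (a b : vertex) (p q r : nat) :
  prime p -> prime q -> prime r ->
  val b = ((val a * p + 1) * q - 1) * r -> dist a b <= 5.
Proof.
move=> pp pq pr eb; have a0 : 0 < val a := valP a.
have q1 := prime_gt1 pq; have p0 := prime_gt0 pp.
have h1 : 0 < val a * p by rewrite muln_gt0 a0.
have h3 : 0 < (val a * p + 1) * q by rewrite muln_gt0 addn1 (prime_gt0 pq).
have h4 : 0 < (val a * p + 1) * q - 1.
  by rewrite subn_gt0 (leq_trans q1) // leq_pmull // addn1.
pose v n (h : 0 < n) : vertex := exist (fun n => is_true (0 < n)) n h.
have w0 : walk a a 0 by exists [::].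
have w1 := walk_rcons w0 (adj_mul_prime pp (erefl : val (v _ h1) = val a * p)).
have w2 := walk_rcons w1
  (adj_succ (erefl : val (v _ (ltn0Sn (val a * p))) = (val (v _ h1)).+1)).
have w3 : walk a (v _ h3) 3.
  by apply: (walk_rcons w2); apply: (adj_mul_prime pq); rewrite /= addn1.
have w4 : walk a (v _ h4) 4.
  by apply: (walk_rcons w3); rewrite adjC; apply: adj_succ; rewrite /= subn1 prednK.
by apply: dist_le_walk; apply: (walk_rcons w4); apply: (adj_mul_prime pr).
Qed.

Lemma infinite_vertices (A : set vertex) :
  (forall B, exists2 b, A b & B < val b) -> infinite_set A.
Proof.
move=> unb /finite_seqP[s As].
have [b Ab] := unb (\max_(x <- s) val x); rewrite ltnNge => /negP; apply.
by apply: leq_bigmax_seq => //; move: Ab; rewrite As.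
Qed.

Lemma exists_dist_le5 (a : vertex) (M : nat) (beta : int) (B : nat) : 0 < M ->
  (exists n : int, arith_prog M beta n /\ same_parity n (Posz (val a))) ->
  exists b : vertex, [/\ arith_prog M beta (Posz (val b)),
    same_parity (Posz (val b)) (Posz (val a)), dist a b <= 5 & B < val b].
Proof.
move=> M0 [n [nM na]]; rewrite /arith_prog /= /same_parity in nM na *.
(* The residue modulo [4 * M] records both the class modulo [M] and the parity, and this modulus is
   divisible by 4 as [exists_prime_steps] requires. *)
pose N := `|(n %% (4 * M)%N%:Z)%Z|%N.
have M4 : 0 < 4 * M by lia.
have NE : Posz N = (n %% (4 * M)%N%:Z)%Z.
  by rewrite /N gez0_abs // modz_ge0 //; lia.
have red (d : nat) (b : nat) : d %| 4 * M -> b = N %[mod 4 * M] ->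
    (Posz b = n %[mod d%:Z])%Z.
  move=> dM /(congr1 Posz); rewrite -!modz_nat NE modz_mod => e.
  apply/eqP; rewrite eqz_mod_dvd; apply: (dvdz_trans (n := (4 * M)%N%:Z)) => //.
  by rewrite -eqz_mod_dvd e.
have par : odd (val a) = odd N.
  have : (Posz (val a) = Posz N %[mod 2])%Z by rewrite -na (red 2 N) // dvdn_mulr.
  by move=> /(congr1 absz); rewrite (modz_nat _ 2) (modz_nat _ 2) /=; lia.
have [p [q [r [pp pq pr rB e]]]] := exists_prime_steps M4 (dvdn_mulr M (dvdnn 4)) B par.
have q1 := prime_gt1 pq.
have h4 : 0 < (val a * p + 1) * q - 1.
  by rewrite subn_gt0 (leq_trans q1) // leq_pmull // addn1.
have hb : 0 < ((val a * p + 1) * q - 1) * r by rewrite muln_gt0 h4 (prime_gt0 pr).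
exists (exist (fun n => is_true (0 < n)) _ hb); split=> /=.
- by rewrite (red M) // dvdn_mull.
- by rewrite (red 2) // dvdn_mulr.
- exact: (dist_prime_steps pp pq pr).
- by rewrite (leq_trans rB) // leq_pmull.
Qed.

Theorem proposition6p1 (a : vertex) :
  (forall (M : nat) (beta : int), 0 < M ->
     infinite_set [set b : vertex |
       arith_prog M beta (Posz (val b)) /\ dist a b <= 6])
  /\
  (forall (M : nat) (beta : int), 0 < M ->
     (exists n : int, arith_prog M beta n /\ same_parity n (Posz (val a))) ->
     infinite_set [set b : vertex |
       [/\ arith_prog M beta (Posz (val b)),
           same_parity (Posz (val b)) (Posz (val a)) &
           dist a b <= 5]]).
Proof.
split=> M beta M0; last first.
  move=> ex; apply: infinite_vertices => B.
  by have [b [bM ba db Bb]] := exists_dist_le5 B M0 ex; exists b.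
apply: infinite_vertices => B.
(* If [beta] has the wrong parity, the class of [beta - 1] is reached in five steps, and a sixth
   step adds 1. *)
have [even|odd] : same_parity beta (Posz (val a)) \/
    same_parity (beta - 1)%R (Posz (val a)).
- by rewrite /same_parity; lia.
- have [|b [bM _ db Bb]] := @exists_dist_le5 a M beta B M0; first by exists beta.
  by exists b => //; split=> //; apply: leq_trans db _.
have [|b [bM _ db Bb]] := @exists_dist_le5 a M (beta - 1)%R B M0.
  by exists (beta - 1)%R.
pose b' : vertex := exist (fun n => is_true (0 < n)) _ (ltn0Sn (val b)).
exists b'; last by rewrite /= ltnW.
split; last first.
  apply: leq_trans (dist_le_walk (walk_rcons (walk_dist a b) (adj_succ _))) _ => //.
rewrite /arith_prog /= in bM *.
by rewrite -addn1 PoszD -modzDml bM modzDml subrK.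
Qed.
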